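(* Let $X$ be a continuous time irreducible, non-explosive Markov chain on a finite or countable state space $S$ with conservative $q$-matrix $Q=(q_{ij})$, let $D\subset S$, $E=S\setminus D$, and $T=\inf\{t\ge0:X_t\in D\}$. Let $\{E_1,E_2,\dots\}$ be a finite or infinite partition of $S$ containing at least two elements and with $E_1=D$ (in particular $\{E_2,E_3,\dots\}$ is a partition of $E$). Assume that: (i) for all $k\ge2$ and $l\ge1$ and for all $i\in E_k$, the quantity $\sum_{j\in E_l}q_{ij}$ does not depend on $i$; for $i\in E_k$, set $\bar q_{kl}:=\sum_{j\in E_l}q_{ij}$. Let $\mu$ be a distribution on $E_\Delta=E\cup\{\Delta\}$ with support in $E$, and set $\bar\mu_k=\sum_{i\in E_k}\mu_i$, with $\mu_i=0$ for $i\in D$. The following two conditions are equivalent. (ii) For all $k\ge1$, the quantity $\mathbb{P}_\mu(X_t\in E_k\mid T>t)$ does not depend on $t\ge0$; more specifically, $\mathbb{P}_\mu(X_t\in E_k\mid T>t)=\bar\mu_k$ for all $t\ge0$. (iii) There exists $\alpha>0$ such that $$\bar\mu\bar Q=-\alpha\bar\mu+\alpha\,\mathrm{d},$$ where $\bar Q=(\bar q_{kl})_{k,l\ge1}$, $\bar q_{1k}=0$ for $k\ge1$, $\bar q_{kk}=-\sum_{l\ge1,\,l\ne k}\bar q_{kl}$ for $k\ge1$, $\bar\mu=(\bar\mu_k)_{k\ge1}$ and $\mathrm{d}=(1,0,0,\dots)$. Moreover, if conditions (i) and (ii) (or equivalently conditions (i) and (iii)) are satisfied, then $T$ is exponentially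 distributed under $\mathbb{P}_\mu$, with parameter $\alpha$ given by $$\alpha=\sum_{k\ge1}\bar q_{k1}\bar\mu_k.$$
   Context: $X=\{(X_t)_{t\ge0},(\mathbb{P}_i)_{i\in S}\}$ is a continuous time irreducible Markov chain with finite or countable state space $S$, transition semigroup $P(t)=\{p_{ij}(t):i,j\in S\}$ and $q$-matrix $Q=\{q_{ij}:i,j\in S\}$, $q_{ij}=p'_{ij}(0)$. It is assumed that $Q$ is conservative, i.e. $\sum_{j\in S}q_{ij}=0$ for all $i\in S$, and that $X$ is non-explosive. $\Delta$ is a cemetery point added to $E$; a distribution on $E_\Delta$ with support in $E$ is a probability measure $\mu$ with $\mu_\Delta=0$, i.e. a probability measure on $E$, and $\mathbb{P}_\mu=\sum_{i\in E}\mu_i\mathbb{P}_i$. Indices $k,l\ge1$ range over the indices of the elements of the partition (finitely or infinitely many); vectors such as $\bar\mu$ and $\mathrm{d}$ are row vectors indexed by these. *)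

(* Defs.v *)
From HB Require Import structures.
From mathcomp Require Import all_boot all_order all_algebra.
From mathcomp Require Import all_classical all_reals all_analysis.

Set Implicit Arguments.
Unset Strict Implicit.
Unset Printing Implicit Defensive.

Import Order.TTheory GRing.Theory Num.Theory.
Import numFieldNormedType.Exports.

Local Open Scope classical_set_scope.
Local Open Scope ring_scope.
Local Open Scope ereal_scope.

(* Unordered sum of signed terms: [\esum] is only meaningful for nonnegative
   ones. Sums stay in [\bar R], so that a divergent sum is never equal to a
   real number. *)
Definition ssum (R : realType) (T : choiceType) (A : set T) (f : T -> \bar R) :
    \bar R :=
  \esum_(x in A) f^\+ x - \esum_(x in A) f^\- x.

(* Processes are indexed by [R], but only times [0 <= t] are ever considered. *)

Definition past (R : realType) (Omega : Type) (S : countType)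
    (X : R -> Omega -> S) (s : R) : set (set Omega) :=
  <<s [set B | exists (u : R) i, (0 <= u <= s)%R /\ B = X u @^-1` [set i]] >>.

Definition transition (R : realType) (d : measure_display)
    (Omega : measurableType d) (S : countType) (X : R -> Omega -> S)
    (P : S -> probability Omega R) (t : R) (i j : S) : R :=
  fine (P i (X t @^-1` [set j])).

Record markov_chain (R : realType) (d : measure_display)
    (Omega : measurableType d) (S : countType) (X : R -> Omega -> S)
    (P : S -> probability Omega R) : Prop := MarkovChain {
  mc_measurable : forall t i, (0 <= t)%R -> measurable (X t @^-1` [set i]);
  (* right-continuity for the discrete topology of the state space *)
  mc_right_continuous : forall w t, (0 <= t)%R ->
    \forall s \near t^'+, X s w = X t w;
  mc_start : forall i, P i (X 0%R @^-1` [set i]) = 1;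
  mc_markov : forall i s t A j k, (0 <= s)%R -> (0 <= t)%R -> past X s A ->
    P i (A `&` X s @^-1` [set j] `&` X (s + t)%R @^-1` [set k]) =
    P i (A `&` X s @^-1` [set j]) * (transition X P t j k)%:E
}.

Definition irreducible_chain (R : realType) (d : measure_display)
    (Omega : measurableType d) (S : countType) (X : R -> Omega -> S)
    (P : S -> probability Omega R) : Prop :=
  forall i j, exists2 t : R, (0 < t)%R & (0 < transition X P t i j)%R.

Definition is_qmatrix (R : realType) (d : measure_display)
    (Omega : measurableType d) (S : countType) (X : R -> Omega -> S)
    (P : S -> probability Omega R) (q : S -> S -> R) : Prop :=
  forall i j,
    ((transition X P t i j - transition X P 0 i j) / t)%R @[t --> 0%R^'+]
      --> q i j.

Definition conservative (R : realType) (S : countType) (q : S -> S -> R) :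
    Prop :=
  forall i, ssum setT (fun j => (q i j)%:E) = 0.

(* The value is [+oo] when there is no further jump. *)
Fixpoint jump_time (R : realType) (Omega : Type) (S : countType)
    (X : R -> Omega -> S) (n : nat) (w : Omega) : \bar R :=
  if n is m.+1 then
    ereal_inf [set s%:E | s in
      [set s : R | jump_time X m w < s%:E /\
                   X s w <> X (fine (jump_time X m w)) w]]
  else 0.

Definition non_explosive (R : realType) (d : measure_display)
    (Omega : measurableType d) (S : countType) (X : R -> Omega -> S)
    (P : S -> probability Omega R) : Prop :=
  forall i, {ae P i, forall w,
    ereal_sup (range (fun n => jump_time X n w)) = +oo}.

Definition hitting_time (R : realType) (Omega : Type) (S : countType)
    (X : R -> Omega -> S) (D : set S) (w : Omega) : \bar R :=
  ereal_inf [set t%:E | t in [set t : R | (0 <= t)%R /\ D (X t w)]].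

(* A distribution on [E] together with a cemetery point, supported in
   [E = ~` D], extended by 0 on [D]. *)
Definition distribution_off (R : realType) (S : countType) (D : set S)
    (mu : S -> R) : Prop :=
  [/\ forall i, (0 <= mu i)%R,
      forall i, D i -> mu i = 0%R &
      \esum_(i in ~` D) (mu i)%:E = 1].

Definition P_init (R : realType) (d : measure_display)
    (Omega : measurableType d) (S : countType)
    (P : S -> probability Omega R) (D : set S) (mu : S -> R)
    (A : set Omega) : \bar R :=
  \esum_(i in ~` D) ((mu i)%:E * P i A).

(* [P_mu (A | B)] *)
Definition P_cond (R : realType) (d : measure_display)
    (Omega : measurableType d) (S : countType)
    (P : S -> probability Omega R) (D : set S) (mu : S -> R)
    (A B : set Omega) : R :=
  (fine (P_init P D mu (A `&` B)) / fine (P_init P D mu B))%R.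

Definition block_rate (R : realType) (S I : countType) (q : S -> S -> R)
    (E : I -> set S) (i : S) (l : I) : \bar R :=
  ssum (E l) (fun j => (q i j)%:E).

(* Blocks are indexed by an arbitrary countable type; [k1] is the index of the
   block [D]. *)
Definition lumpable_off (R : realType) (S I : countType) (q : S -> S -> R)
    (E : I -> set S) (k1 : I) : Prop :=
  forall k l, k != k1 -> forall i i', E k i -> E k i' ->
    block_rate q E i l = block_rate q E i' l.

(* The common value of [block_rate q E i l] over [i] in [E k]; the default 0 is
   used only if there is no common value. *)
Definition common_rate (R : realType) (S I : countType) (q : S -> S -> R)
    (E : I -> set S) (k l : I) : \bar R :=
  xget 0 [set r | forall i, E k i -> block_rate q E i l = r].

(* For [k != k1] the diagonal entry is also [common_rate q E k k], because
   [q] is conservative. *)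
Definition lumped_qmatrix (R : realType) (S I : countType) (q : S -> S -> R)
    (E : I -> set S) (k1 : I) (k l : I) : \bar R :=
  if k == k1 then 0
  else if k == l then - ssum [set m | m != k] (common_rate q E k)
  else common_rate q E k l.

Definition block_mass (R : realType) (S I : countType) (E : I -> set S)
    (mu : S -> R) (k : I) : \bar R :=
  \esum_(i in E k) (mu i)%:E.

Definition lumped_equation (R : realType) (I : countType)
    (Qbar : I -> I -> \bar R) (mubar : I -> \bar R) (k1 : I) (alpha : R) :
    Prop :=
  forall l, ssum setT (fun k => mubar k * Qbar k l) =
    - alpha%:E * mubar l + alpha%:E * (l == k1)%:R%:E.

Definition exponentially_distributed (R : realType) (d : measure_display)
    (Omega : measurableType d) (Pr : set Omega -> \bar R)
    (T : Omega -> \bar R) (alpha : R) : Prop :=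
  (0 < alpha)%R /\
  forall B : set R, measurable B ->
    Pr (T @^-1` (EFin @` B)) = exponential_prob alpha B.

(* Main.v *)
Require Import Defs.
From HB Require Import structures.
From mathcomp Require Import all_boot all_order all_algebra.
From mathcomp Require Import all_classical all_reals all_analysis.
From mathcomp Require Import measurable_realfun ring lra.

(* For a finite set [G] of states, the masses [r i j t] of the paths from [i] to
   [j] that stay in [G] up to time [t] form a semigroup of finite matrices: it is
   a limit of matrix powers along dyadic grids, and its generator is [q]
   restricted to [G], so it solves a finite linear system. Non-explosion lets [G]
   exhaust the state space: the mass that leaks out of [G] other than through [D]
   vanishes, and for [B] disjoint from [D] one gets the mass balance
     P_mu (X_t in B, T > t) + (expected flow from B up to t)
       = mu B + (expected flow from ~D \ B into B up to t).
   By lumpability the flows between blocks depend only on the occupation times of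
   the blocks; only forward equations are used, so lumpability of the killed
   semigroup itself is never needed.
   (ii) => (iii): the survival function [phi] satisfies phi + a * int phi = 1,
   hence is exponential; the balance of the other blocks is the other columns.
   (iii) => (ii): expR (- a t) * mubar solves the lumped forward system, whereas
   the lumped masses on a finite [G] form a subsolution, so P_mu (X_t in E_k, T > t)
   <= expR (- a t) * mubar_k. The mass balance of [~D] then bounds the survival
   function from below by expR (- a t), so all these inequalities are equalities. *)

Set Implicit Arguments.
Unset Strict Implicit.
Unset Printing Implicit Defensive.

Import Order.TTheory GRing.Theory Num.Theory.
Import numFieldNormedType.Exports.

Local Open Scope classical_set_scope.
Local Open Scope ring_scope.
Local Open Scope ereal_scope.

(** * Path events *)

Section killed_paths.
Context (R : realType) (d : measure_display) (Omega : measurableType d)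
  (S : countType) (X : R -> Omega -> S) (P : S -> probability Omega R).

(** States and blocks may be infinite in number and the rates unbounded, so an infinite forward
    system can neither be differentiated term by term nor be presumed to have unique solutions. On a
    finite [G] both difficulties vanish, at a price: the rows of [q] restricted to [G] no longer sum
    to zero. The following choices make the return to the infinite space possible. Dyadic grids are
    nested, so the event of staying in [G] is a decreasing limit of grid events and inherits the
    Markov property. The forward equations are integrated and every term is put on the side where it
    is nonnegative, so that each one has a limit in [0, +oo] and no difference of infinities occurs.
    The leak is handled without any bound on the rates: when the target is the whole space, it
    equals the mass lost by time [t], and every other leak is dominated by that one. Differentiation
    takes place only on finite sets, where a comparison principle for finitely many blocks is
    enough. *)

Definition on_grid (A : set S) (t dt : R) (N : nat) : set Omega :=
  [set w | forall k, (k <= N)%N -> A (X (t + k%:R * dt)%R w)].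

Definition stay_from (A : set S) (t h : R) : set Omega :=
  [set w | forall u, (0 <= u <= h)%R -> A (X (t + u)%R w)].

Definition stay (A : set S) (t : R) := stay_from A 0%R t.

Context (X_markov : markov_chain X P).

Lemma dyadic_mesh_lt (h e : R) : (0 < e)%R -> exists n, (h / (2 ^ n)%:R < e)%R.
Proof.
move=> e0; exists (Num.bound (h / e)).
rewrite ltr_pdivrMr ?ltr0n ?expn_gt0// -ltr_pdivrMl// mulrC.
have [h0|h0] := leP 0%R h.
  apply: lt_trans (archi_boundP (divr_ge0 h0 (ltW e0))) _.
  by rewrite ltr_nat; exact: ltn_expl.
apply: (@lt_le_trans _ _ 0%R); first by rewrite ltr_pdivrMr// mul0r.
by rewrite ler0n.
Qed.

(** A right-continuous path in a discrete space that leaves [A] is outside [A] during a whole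
    interval to the right, and a fine enough grid meets it. This replaces an uncountable
    intersection by a countable one, hence by a measurable event. *)
Lemma stay_fromE (A : set S) (t h : R) : (0 <= t)%R -> (0 <= h)%R ->
  stay_from A t h = \bigcap_n on_grid A t (h / (2 ^ n)%:R) (2 ^ n).
Proof.
move=> t0 h0; apply/seteqP; split=> w /=.
  move=> Aw n _ k kn; apply: Aw; rewrite mulr_ge0 ?divr_ge0//=.
  rewrite mulrCA ler_piMr// ler_pdivrMr ?ltr0n ?expn_gt0// mul1r ler_nat//.
move=> Aw u /andP[u0 uh].
(* At [u = h] there is no room to the right, but [t + h] is a grid point of level 0. *)
have [uh'|] := ltP u h; last first.
  move=> hu; have -> : u = (1 * (h / (2 ^ 0)%:R))%R.
    by rewrite expn0 divr1 mul1r; apply/eqP; rewrite eq_le uh hu.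
  exact: (Aw 0%N I 1%N).
have /nbhs_right0P : \forall s \near (t + u)%R^'+, X s w = X (t + u)%R w.
  by apply: (mc_right_continuous X_markov); rewrite addr_ge0.
move=> [e /= e0 Xe].
have /(dyadic_mesh_lt h)[n hn] : (0 < Num.min e (h - u))%R.
  by rewrite lt_min e0 subr_gt0.
move: hn; rewrite lt_min; set dt := (h / _)%R => /andP[dte dthu].
have dt0 : (0 < dt)%R.
  by rewrite divr_gt0 ?ltr0n ?expn_gt0// (le_lt_trans u0).
have /truncn_itv/andP[ku uk] : (0 <= u / dt)%R by rewrite divr_ge0// ltW.
(* [k.+1 * dt] is the first grid time after [u]: it is within [e] of [u], where the path still has
   its value at [t + u], and it does not exceed [h]. *)
set k := Num.trunc _ in ku uk.
move: ku uk; rewrite ler_pdivlMr// ltr_pdivrMr// => ku uk.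
have kdt : (k.+1%:R * dt = u + (k.+1%:R * dt - u))%R by rewrite addrC subrK.
have kdt_le : (k.+1%:R * dt <= u + dt)%R.
  by rewrite -natr1 mulrDl mul1r lerD2r.
rewrite -(Xe (k.+1%:R * dt - u)%R) /=.
- rewrite -addrA -kdt; apply: (Aw n I) => //.
  have : (k.+1%:R * dt <= h)%R.
    by apply: le_trans kdt_le _; rewrite -lerBrDl ltW.
  by rewrite mulrCA ger_pMr ?(le_lt_trans u0)// ler_pdivrMr ?ltr0n ?expn_gt0// mul1r ler_nat.
- rewrite sub0r normrN gtr0_norm ?subr_gt0//.
  by apply: le_lt_trans dte; rewrite lerBlDl.
- by rewrite subr_gt0.
Qed.

(** Halving the mesh keeps the old grid points; this monotonicity is what later allows continuity
    from above. *)
Lemma on_grid_nonincr (A : set S) (t h : R) :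
  {homo (fun n => on_grid A t (h / (2 ^ n)%:R) (2 ^ n)) :
    n m / (n <= m)%N >-> (m <= n)%O}.
Proof.
apply: (homo_leq (r := fun x y => (y <= x)%O)) => [x//|x y z xy yz|n].
  exact: le_trans yz xy.
apply/subsetPset => w Aw k kn.
have -> : (k%:R * (h / (2 ^ n)%:R) = (2 * k)%:R * (h / (2 ^ n.+1)%:R) :> R)%R.
  by rewrite expnS !natrM; field; rewrite pnatr_eq0 expn_eq0.
by apply: Aw; rewrite expnS leq_mul2l kn orbT.
Qed.

Local Notation past_type s := (g_sigma_algebraType
  [set B : set Omega | exists (u : R) i,
    (0 <= u <= s)%R /\ B = X u @^-1` [set i]]).

Lemma past_measurable (s : R) (B : set Omega) : past X s B -> measurable B.
Proof.
move=> sB; apply: sB; split; first exact: sigma_algebra_measurable.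
by move=> _ [u [i [/andP[u0 _] ->]]]; exact: (mc_measurable X_markov).
Qed.

Lemma past_le (s s' : R) (B : set Omega) : (s <= s')%R -> past X s B ->
  past X s' B.
Proof.
move=> ss' sB; apply: sB; split; first exact: smallest_sigma_algebra.
move=> _ [u [i [/andP[u0 us] ->]]]; apply: sub_sigma_algebra.
by exists u, i; rewrite u0 (le_trans us).
Qed.

Lemma pastI (s : R) (B C : set Omega) : past X s B -> past X s C ->
  past X s (B `&` C).
Proof. exact: (@measurableI _ (past_type s)). Qed.

Lemma pastT (s : R) : past X s setT.
Proof. exact: (@measurableT _ (past_type s)). Qed.

Lemma past_bigcap (s : R) (F : nat -> set Omega) :
  (forall n, past X s (F n)) -> past X s (\bigcap_n F n).
Proof. exact: (@bigcapT_measurable _ (past_type s)). Qed.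

Lemma past_preimage (s u : R) (A : set S) : (0 <= u <= s)%R ->
  past X s (X u @^-1` A).
Proof.
move=> us.
have -> : X u @^-1` A = \bigcup_i (if i \in A then X u @^-1` [set i] else set0).
  apply/seteqP; split=> w /= => [Aw|[i _]].
    by exists (X u w) => //; rewrite mem_set.
  by case: ifPn => // /set_mem Ai ->.
apply: (@countable_bigcupT_measurable _ (past_type s)); first exact: countableP.
move=> i; case: ifPn => _; last exact: (@measurable0 _ (past_type s)).
by apply: sub_sigma_algebra; exists u, i.
Qed.

Lemma past_on_grid (A : set S) (s t dt : R) N : (0 <= t)%R -> (0 <= dt)%R ->
  (t + N%:R * dt <= s)%R -> past X s (on_grid A t dt N).
Proof.
move=> t0 dt0 ts.
have -> : on_grid A t dt N =
    \bigcap_k (if (k <= N)%N then X (t + k%:R * dt)%R @^-1` A else setT).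
  apply/seteqP; split=> w /= Aw k.
    by move=> _; case: ifPn => // /Aw.
  by move=> kN; have := Aw k I; rewrite kN.
apply: past_bigcap => k; case: ifPn => [kN|_]; last exact: pastT.
apply: past_preimage; rewrite addr_ge0 ?mulr_ge0//=.
by apply: le_trans ts; rewrite lerD2l ler_wpM2r// ler_nat.
Qed.

Lemma past_stay_from (A : set S) (t h : R) : (0 <= t)%R -> (0 <= h)%R ->
  past X (t + h) (stay_from A t h).
Proof.
move=> t0 h0; rewrite stay_fromE//; apply: past_bigcap => n.
apply: past_on_grid => //; first by rewrite divr_ge0.
by rewrite mulrC divfK// pnatr_eq0 expn_eq0.
Qed.

Lemma past_stay (A : set S) (t : R) : (0 <= t)%R -> past X t (stay A t).
Proof. by move=> t0; have := past_stay_from A (lexx 0%R) t0; rewrite add0r. Qed.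

End killed_paths.

(** * The semigroup of the chain killed outside a finite set *)

Lemma measure_preimage_seq (R : realType) (d : measure_display)
    (Omega : measurableType d) (S : eqType) (mu : probability Omega R)
    (f : Omega -> S) (A : set Omega) (G : seq S) :
  measurable A -> (forall k, measurable (f @^-1` [set k])) -> uniq G ->
  mu (A `&` f @^-1` [set` G]) = \sum_(k <- G) mu (A `&` f @^-1` [set k]).
Proof.
move=> mA mf; elim: G => [_|k G IH /= /andP[kG uG]].
  rewrite big_nil (_ : _ `&` _ = set0) ?measure0//.
  by apply/seteqP; split=> w //= [].
have mG (s : seq S) : measurable (f @^-1` [set` s]).
  have -> : f @^-1` [set` s] = \big[setU/set0]_(i <- s) f @^-1` [set i].
    elim: s {IH uG kG} => [|i s IHs]; first by rewrite big_nil; apply/seteqP; split.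
    rewrite big_cons -IHs; apply/seteqP; split=> w /=; rewrite in_cons.
      by move=> /orP[/eqP|]; [left|right].
    by move=> [->|->]; rewrite ?eqxx ?orbT.
  exact: bigsetU_measurable.
rewrite big_cons -IH// -measureU; [|exact: measurableI|exact: measurableI|].
- rewrite -setIUr; congr (mu (_ `&` _)); apply/seteqP; split=> w /=.
    by rewrite in_cons => /orP[/eqP|]; [left|right].
  by rewrite in_cons => -[->|->]; rewrite ?eqxx ?orbT.
- by apply/seteqP; split=> // w /= [[_ fk] [_]]; rewrite fk (negbTE kG).
Qed.

Section killed_semigroup.
Context (R : realType) (d : measure_display) (Omega : measurableType d)
  (S : countType) (X : R -> Omega -> S) (P : S -> probability Omega R).
Context (X_markov : markov_chain X P).

Local Notation p := (transition X P).

Let mX t i : (0 <= t)%R -> measurable (X t @^-1` [set i]).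
Proof. exact: (mc_measurable X_markov). Qed.

Lemma transitionE t i j : (0 <= t)%R ->
  (p t i j)%:E = P i (X t @^-1` [set j]).
Proof. by move=> t0; rewrite /transition fineK// fin_num_measure//; exact: mX. Qed.

Lemma transition_ge0 t i j : (0 <= p t i j)%R.
Proof. exact: fine_ge0. Qed.

Lemma transition_le1 t i j : (0 <= t)%R -> (p t i j <= 1)%R.
Proof.
by move=> t0; rewrite -lee_fin transitionE// probability_le1//; exact: mX.
Qed.

Lemma transition0 i j : p 0 i j = (i == j)%:R.
Proof.
apply: EFin_inj; rewrite transitionE//; have [<-|ij] := eqVneq i j.
  exact: (mc_start X_markov).
rewrite mulr0n; apply/eqP; rewrite eq_le measure_ge0 andbT.
apply: (@le_trans _ _ (P i (~` (X 0%R @^-1` [set i])))); last first.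
  by rewrite probability_setC ?(mc_start X_markov) ?subee//; apply: mX.
apply: le_measure; rewrite ?inE; [exact: mX|exact/measurableC/mX|].
by move=> w /= ->; apply/eqP; rewrite eq_sym.
Qed.

Lemma start_setI i (A : set Omega) : measurable A ->
  P i (X 0%R @^-1` [set i] `&` A) = P i A.
Proof.
move=> mA; apply/eqP; rewrite eq_le; apply/andP; split.
  apply: le_measure; rewrite ?inE//.
  by apply: measurableI; [exact: mX|].
have Xi0 : P i (~` (X 0%R @^-1` [set i])) = 0.
  by rewrite probability_setC ?(mc_start X_markov) ?subee//; apply: mX.
apply: (@le_trans _ _ (P i (X 0%R @^-1` [set i] `&` A) +
  P i (~` (X 0%R @^-1` [set i])))); last by rewrite Xi0 adde0.
apply: le_trans _ (measureU2 _ _ _); last 2 first.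
- by apply: measurableI; [exact: mX|].
- exact/measurableC/mX.
apply: le_measure; rewrite ?inE//.
  by apply: measurableU; [apply: measurableI; [exact: mX|]|exact/measurableC/mX].
by move=> w Aw; have [Xw|] := EM (X 0%R w = i); [left|right].
Qed.

(** Entries of the [N]-th power of the matrix [p dt] restricted to [G]. *)
Fixpoint grid_mass (G : seq S) (dt : R) (N : nat) (i j : S) : R :=
  if N is N'.+1 then (\sum_(k <- G) grid_mass G dt N' i k * p dt k j)%R
  else (i == j)%:R.

Lemma grid_mass_ge0 G dt N i j : (0 <= grid_mass G dt N i j)%R.
Proof.
elim: N j => [|N IH] j /=; first by rewrite ler0n.
by apply: sumr_ge0 => k _; rewrite mulr_ge0// transition_ge0.
Qed.

(** The Markov property iterated along the grid. The past event [B] is arbitrary so that the limit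
    over the grids is again a Markov property. *)
Lemma grid_markov (G : seq S) (B : set Omega) (t dt : R) N i m j :
  uniq G -> past X t B -> (0 <= t)%R -> (0 <= dt)%R -> m \in G -> j \in G ->
  P i (B `&` X t @^-1` [set m] `&` on_grid X [set` G] t dt N `&`
       X (t + N%:R * dt)%R @^-1` [set j]) =
  P i (B `&` X t @^-1` [set m]) * (grid_mass G dt N m j)%:E.
Proof.
move=> uG tB t0 dt0 mG; elim: N j => [|N IH] j jG /=.
  rewrite mul0r addr0; have [<-|mj] := eqVneq m j.
    rewrite mule1; congr (P i _); apply/seteqP; split=> w /=; first by case=> -[].
    move=> [Bw Xw]; do !split=> //; move=> k; rewrite leqn0 => /eqP ->.
    by rewrite mul0r addr0 Xw.
  rewrite mule0 (_ : _ `&` _ = set0) ?measure0//.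
  apply/seteqP; split=> w //= [[[_ Xm] _] Xj].
  by move: mj; rewrite -Xm -Xj eqxx.
set s := (t + N%:R * dt)%R.
have s0 : (0 <= s)%R by rewrite addr_ge0// mulr_ge0.
have sS : (t + N.+1%:R * dt = s + dt)%R by rewrite -natr1 mulrDl mul1r addrA.
rewrite sS.
pose C := B `&` X t @^-1` [set m] `&` on_grid X [set` G] t dt N.
have sC : past X s C.
  apply: pastI; last exact: past_on_grid.
  apply: (@past_le _ _ _ _ _ t); first by rewrite lerDl mulr_ge0.
  by apply: pastI => //; apply: past_preimage => //; rewrite t0 lexx.
(* The new constraint at the last grid time follows from [j \in G]; what remains is a past event for
   [s], which is split along the position at [s]. *)
have -> : B `&` X t @^-1` [set m] `&` on_grid X [set` G] t dt N.+1 `&`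
     X (s + dt)%R @^-1` [set j] =
     C `&` X (s + dt)%R @^-1` [set j] `&` X s @^-1` [set` G].
  apply/seteqP; split=> w /=.
    move=> [[[Bw Xm] gw] Xj]; do !split => //.
      by move=> k kN; apply: gw; rewrite (leq_trans kN).
    by apply: gw.
  move=> [[[[Bw Xm] gw] Xj] Xs]; do !split=> //.
  move=> k; rewrite leq_eqVlt => /predU1P[->|]; last exact: gw.
  by rewrite sS Xj.
rewrite measure_preimage_seq//; last 2 first.
- by apply: measurableI; [exact: (past_measurable X_markov sC)|apply: mX; rewrite addr_ge0].
- by move=> k; exact: mX.
rewrite -sumEFin ge0_sume_distrr; last by move=> k _; rewrite lee_fin mulr_ge0 ?grid_mass_ge0 ?transition_ge0.
rewrite !big_seq; apply: eq_bigr => k kG.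
rewrite -setIA [X (s + dt)%R @^-1` _ `&` _]setIC setIA (mc_markov X_markov)// IH// EFinM muleA//.
Qed.

End killed_semigroup.

Lemma cvg_sum_seq (R : realFieldType) (T : Type) (F : set_system T)
    (FF : Filter F) (I : eqType) (s : seq I) (f : I -> T -> R) (l : I -> R) :
  (forall i, i \in s -> f i x @[x --> F] --> l i) ->
  (\sum_(i <- s) f i x)%R @[x --> F] --> (\sum_(i <- s) l i)%R.
Proof.
elim: s => [_|i s IH fl].
  rewrite big_nil; under eq_fun do rewrite big_nil; exact: cvg_cst.
rewrite big_cons; under eq_fun do rewrite big_cons.
apply: cvgD; first by apply: fl; exact: mem_head.
by apply: IH => j js; apply: fl; rewrite in_cons js orbT.
Qed.

Lemma bernoulli_ineq (R : realDomainType) (x : R) (n : nat) :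
  (0 <= x <= 1)%R -> (1 - n%:R * (1 - x) <= x ^+ n)%R.
Proof.
move=> /andP[x0 x1]; elim: n => [|n IH]; first by rewrite mul0r subr0.
have [xn0 xn1] : (0 <= x ^+ n)%R /\ (x ^+ n <= 1)%R.
  by split; [exact: exprn_ge0|exact: exprn_ile1].
by rewrite exprS -natr1; nra.
Qed.

Section killed.
Context (R : realType) (d : measure_display) (Omega : measurableType d)
  (S : countType) (X : R -> Omega -> S) (P : S -> probability Omega R).
Context (X_markov : markov_chain X P).

Local Notation p := (transition X P).

Let mX t i : (0 <= t)%R -> measurable (X t @^-1` [set i]).
Proof. exact: (mc_measurable X_markov). Qed.

Definition killed (A : set S) (t : R) (i j : S) : R :=
  fine (P i (stay X A t `&` X t @^-1` [set j])).

Lemma measurable_stay A t : (0 <= t)%R -> measurable (stay X A t).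
Proof.
by move=> t0; apply: (past_measurable X_markov (past_stay X_markov A t0)).
Qed.

Lemma measurable_stayX A t j : (0 <= t)%R ->
  measurable (stay X A t `&` X t @^-1` [set j]).
Proof. by move=> t0; apply: measurableI; [exact: measurable_stay|exact: mX]. Qed.

Lemma killedE A t i j : (0 <= t)%R ->
  (killed A t i j)%:E = P i (stay X A t `&` X t @^-1` [set j]).
Proof.
by move=> t0; rewrite /killed fineK// fin_num_measure//; exact: measurable_stayX.
Qed.

Lemma killed_ge0 A t i j : (0 <= killed A t i j)%R.
Proof. exact: fine_ge0. Qed.

Lemma killed_subset (A B : set S) t i j : (0 <= t)%R -> A `<=` B ->
  (killed A t i j <= killed B t i j)%R.
Proof.
move=> t0 AB; rewrite -lee_fin !killedE//; apply: le_measure; rewrite ?inE.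
- exact: measurable_stayX.
- exact: measurable_stayX.
- by apply: setSI => w Aw u /Aw/AB.
Qed.

Lemma killed_le_transition A t i j : (0 <= t)%R ->
  (killed A t i j <= p t i j)%R.
Proof.
move=> t0; rewrite -lee_fin killedE// transitionE//.
apply: le_measure; rewrite ?inE; [exact: measurable_stayX|exact: mX|].
exact: subIsetr.
Qed.

Lemma killed0 A i j : A i -> killed A 0 i j = (i == j)%:R.
Proof.
move=> Ai; rewrite -(transition0 X_markov); apply: EFin_inj.
rewrite killedE// transitionE// -(start_setI X_markov); last exact: measurable_stayX.
rewrite -[RHS](start_setI X_markov); last exact: mX.
congr (P i _); apply/seteqP; split=> w /= [X0]; first by case.
move=> X0j; do !split=> //; move=> u /le_anti <-.
by rewrite addr0 X0.
Qed.

Section finite_set.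
Context (G : seq S) (uG : uniq G).

(** By [grid_markov] the terms of the sequence are probabilities of grid events; these events
    decrease, and their intersection is the event on the right. *)
Lemma killed_grid_cvg (B : set Omega) t h i m j :
  past X t B -> (0 <= t)%R -> (0 <= h)%R -> m \in G -> j \in G ->
  P i (B `&` X t @^-1` [set m]) *
    (grid_mass X P G (h / (2 ^ n)%:R) (2 ^ n) m j)%:E @[n --> \oo] -->
  P i (B `&` X t @^-1` [set m] `&` stay_from X [set` G] t h `&`
       X (t + h)%R @^-1` [set j]).
Proof.
move=> tB t0 h0 mG jG.
pose F n := B `&` X t @^-1` [set m] `&`
  on_grid X [set` G] t (h / (2 ^ n)%:R) (2 ^ n) `&` X (t + h)%R @^-1` [set j].
have hE n : (h = (2 ^ n)%:R * (h / (2 ^ n)%:R))%R.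
  by rewrite mulrC divfK// pnatr_eq0 expn_eq0.
have mF n : measurable (F n).
  apply: (past_measurable X_markov (s := (t + h)%R)).
  apply: pastI; last by apply: past_preimage; rewrite lexx addr_ge0.
  apply: pastI; last by apply: past_on_grid; rewrite ?divr_ge0// -hE.
  apply: (@past_le _ _ _ _ _ t); first by rewrite lerDl.
  by apply: pastI => //; apply: past_preimage; rewrite t0 lexx.
have -> : B `&` X t @^-1` [set m] `&` stay_from X [set` G] t h `&`
       X (t + h)%R @^-1` [set j] = \bigcap_n F n.
  rewrite (stay_fromE X_markov)//; apply/seteqP; split=> w /=.
    by move=> [[[Bw Xm] gw] Xj] n _; do !split=> //; exact: gw.
  move=> Fw; have [[[Bw Xm] _] Xj] := Fw 0%N I.
  by split=> //; split=> // n _; have [[_ ?] _] := Fw n I.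
have -> : (fun n => P i (B `&` X t @^-1` [set m]) *
    (grid_mass X P G (h / (2 ^ n)%:R) (2 ^ n) m j)%:E) = P i \o F.
  apply/funext => n /=; rewrite -(grid_markov X_markov)//; last by rewrite divr_ge0.
  by rewrite -hE.
apply: nonincreasing_cvg_mu => //.
- by rewrite ltey_eq fin_num_measure.
- exact: bigcapT_measurable.
- move=> n k nk; apply/subsetPset => w /= [[[Bw Xm] gw] Xj]; do !split=> //.
  by have /subsetPset := on_grid_nonincr X [set` G] t h nk; exact.
Qed.

Lemma grid_mass_cvg h i j : (0 <= h)%R -> i \in G -> j \in G ->
  grid_mass X P G (h / (2 ^ n)%:R) (2 ^ n) i j @[n --> \oo] -->
  killed [set` G] h i j.
Proof.
move=> h0 iG jG; have T0 : past X 0%R setT by exact: pastT.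
have := killed_grid_cvg (i := i) T0 (lexx 0%R) h0 iG jG.
under eq_fun do rewrite setTI (mc_start X_markov) mul1e.
rewrite setTI -setIA add0r (start_setI X_markov); last exact: measurable_stayX.
by rewrite -killedE// => /fine_cvgP[].
Qed.

(** Both sides are limits of the sequence in [killed_grid_cvg]: one by that lemma, the other because
    the matrix powers themselves converge. *)
Lemma killed_markov (B : set Omega) t h i m j :
  past X t B -> (0 <= t)%R -> (0 <= h)%R -> m \in G -> j \in G ->
  P i (B `&` X t @^-1` [set m] `&` stay_from X [set` G] t h `&`
       X (t + h)%R @^-1` [set j]) =
  P i (B `&` X t @^-1` [set m]) * (killed [set` G] h m j)%:E.
Proof.
move=> tB t0 h0 mG jG.
apply: cvg_unique (killed_grid_cvg (i := i) tB t0 h0 mG jG) _ => //.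
apply: cvgeZl.
  rewrite fin_num_measure//; apply: measurableI; last exact: mX.
  exact: (past_measurable X_markov tB).
by apply: cvg_EFin; [near=> n|exact: grid_mass_cvg].
Unshelve. all: by end_near. Qed.

Lemma killed_semigroup t h i j : (0 <= t)%R -> (0 <= h)%R -> j \in G ->
  killed [set` G] (t + h) i j =
  (\sum_(m <- G) killed [set` G] t i m * killed [set` G] h m j)%R.
Proof.
move=> t0 h0 jG; apply: EFin_inj; rewrite killedE ?addr_ge0//.
have -> : stay X [set` G] (t + h) `&` X (t + h)%R @^-1` [set j] =
    stay X [set` G] t `&` stay_from X [set` G] t h `&` X (t + h)%R @^-1` [set j]
    `&` X t @^-1` [set` G].
  apply/seteqP; split=> w /=.
    move=> [sw Xj]; do !split=> //.
    - by move=> u /andP[u0 ut]; apply: sw; rewrite u0 (le_trans ut)// lerDl.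
    - move=> u /andP[u0 uh]; have := sw (t + u)%R; rewrite add0r; apply.
      by rewrite addr_ge0//= lerD2l.
    - by have := sw t; rewrite add0r; apply; rewrite t0 lerDl.
  move=> [[[st sth] Xj] _]; split=> // u /andP[u0 uth].
  have [ut|tu] := leP u t; first by apply: st; rewrite u0.
  have := sth (u - t)%R; rewrite addrCA subrr addr0 add0r; apply.
  by rewrite subr_ge0 ltW//= lerBlDl.
rewrite measure_preimage_seq//; last 2 first.
- apply: measurableI; last by apply: mX; rewrite addr_ge0.
  apply: measurableI; first exact: measurable_stay.
  by apply: (past_measurable X_markov (past_stay_from X_markov _ t0 h0)).
- by move=> k; exact: mX.
rewrite -sumEFin !big_seq; apply: eq_bigr => m mG.
rewrite EFinM killedE// -killed_markov//; last exact: (past_stay X_markov).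
congr (P i _); rewrite -!setIA; congr (_ `&` _).
by rewrite setIA setIC.
Qed.

End finite_set.

End killed.

(** * The forward equation on a finite set of states *)

Section forward_equation.
Context (R : realType) (d : measure_display) (Omega : measurableType d)
  (S : countType) (X : R -> Omega -> S) (P : S -> probability Omega R)
  (q : S -> S -> R).
Context (X_markov : markov_chain X P) (X_qmatrix : is_qmatrix X P q).

Local Notation p := (transition X P).
Local Notation K G t := (killed X P [set` G] t).

Lemma qmatrix_cvg i j :
  ((p h i j - (i == j)%:R) / h)%R @[h --> 0%R^'+] --> q i j.
Proof. by have := @X_qmatrix i j; rewrite (transition0 X_markov). Qed.

Lemma qmatrix_offdiag_ge0 i j : i != j -> (0 <= q i j)%R.
Proof.
move=> ij; apply: ler_cvg_to (cvg_cst 0%R) (@qmatrix_cvg i j) _.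
near=> h; rewrite (negbTE ij) subr0 divr_ge0 ?transition_ge0//.
Unshelve. all: by end_near. Qed.

Lemma qmatrix_diag_le0 i : (q i i <= 0)%R.
Proof.
apply: ler_cvg_to (@qmatrix_cvg i i) (cvg_cst 0%R) _.
near=> h; rewrite eqxx mulr_le0_ge0 ?invr_ge0// subr_le0.
exact: (transition_le1 X_markov).
Unshelve. all: by end_near. Qed.

Lemma qmatrix_cvg_dyadic h i j : (0 < h)%R ->
  ((2 ^ n)%:R * (p (h / (2 ^ n)%:R) i j - (i == j)%:R))%R @[n --> \oo]
    --> (h * q i j)%R.
Proof.
move=> h0; pose u n : R := (h / (2 ^ n)%:R)%R.
have u0 n : (0 < u n)%R by rewrite divr_gt0// ltr0n expn_gt0.
have ucvg : u n @[n --> \oo] --> (0 : R)%R.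
  have : (geometric h 2^-1 n)%R @[n --> \oo] --> (0 : R)%R.
    by apply: cvg_geometric; rewrite ger0_norm ?invf_lt1// ltr1n.
  by apply: cvg_trans; apply: near_eq_cvg; near=> n; rewrite /u/= natrX exprVn.
have := (cvg_at_rightP _ _ _).1 (@qmatrix_cvg i j) u (conj u0 ucvg).
move=> /(cvgM (cvg_cst h)); apply: cvg_trans; apply: near_eq_cvg; near=> n => /=.
rewrite -/(u n) mulrCA mulrC; congr (_ * _)%R.
by rewrite /u invf_div mulrC divfK// gt_eqF.
Unshelve. all: by end_near. Qed.

Section finite_set.
Context (G : seq S) (uG : uniq G).

Lemma sum_seq_delta (f : S -> R) j : j \in G ->
  (\sum_(m <- G) f m * (m == j)%:R = f j)%R.
Proof.
move=> jG; rewrite (bigD1_seq j)//= eqxx mulr1 big1 ?addr0// => m /negbTE ->.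
by rewrite mulr0.
Qed.

(** Only the path that is at [i] at every grid time is kept. *)
Lemma grid_mass_diag dt N i : i \in G ->
  (p dt i i ^+ N <= grid_mass X P G dt N i i)%R.
Proof.
move=> iG; elim: N => [|N IH] /=; first by rewrite eqxx.
rewrite (bigD1_seq i)//= exprSr; apply: ler_wpDr.
  by apply: sumr_ge0 => k _; rewrite mulr_ge0 ?grid_mass_ge0 ?transition_ge0.
by rewrite ler_wpM2r// transition_ge0.
Qed.

(** Only the paths with a single move, from [i] to [j], are kept. There are [N] of them, one for
    each step at which the move can occur, and each has weight at least
    [p dt i j * (p dt i i * p dt j j) ^+ N], the waiting factors being at most 1. *)
Lemma grid_mass_offdiag dt N i j : (0 <= dt)%R -> i \in G -> j \in G -> i != j ->
  (N%:R * p dt i j * (p dt i i * p dt j j) ^+ N <= grid_mass X P G dt N i j)%R.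
Proof.
move=> dt0 iG jG ij; elim: N => [|N IH]; first by rewrite !mul0r grid_mass_ge0.
(* Of the sum over the position before the last step, the terms [j] (already moved) and [i] (moving
   now) are retained. *)
have sum_ge : (grid_mass X P G dt N i j * p dt j j +
    grid_mass X P G dt N i i * p dt i j <= grid_mass X P G dt N.+1 i j)%R.
  pose f k := (grid_mass X P G dt N i k * p dt k j)%R.
  rewrite -/(f j) -/(f i) -(sum_seq_delta f iG) -(sum_seq_delta f jG) -big_split/=.
  apply: ler_sum => k _; have f0 : (0 <= f k)%R.
    by rewrite mulr_ge0 ?grid_mass_ge0 ?transition_ge0.
  rewrite -mulrDr -[leRHS]mulr1 ler_wpM2l// -natrD lern1.
  by have [->|] := eqVneq k j; [rewrite eq_sym (negbTE ij)|rewrite leq_b1].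
apply: le_trans sum_ge; have := grid_mass_diag dt N iG.
have := transition_le1 X_markov i i dt0; have := transition_le1 X_markov j j dt0.
have := transition_ge0 X P dt i i; have := transition_ge0 X P dt j j.
have := transition_ge0 X P dt i j.
move: IH; rewrite !exprMn !exprS -natr1.
set a := p dt i i; set b := p dt j j; set c := p dt i j.
set x := grid_mass _ _ _ _ _ i j; set y := grid_mass _ _ _ _ _ i i.
move=> IH c0 b0 a0 b1 a1 ay.
have aN0 : (0 <= a ^+ N)%R by exact: exprn_ge0.
have bN0 : (0 <= b ^+ N)%R by exact: exprn_ge0.
have bN1 : (b ^+ N <= 1)%R by exact: exprn_ile1.
apply: (@le_trans _ _ (N%:R * c * (a ^+ N * b ^+ N) * b + a ^+ N * c)%R).
  rewrite mulrDl mul1r mulrDl; apply: lerD.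
    rewrite -!mulrA ler_wpM2l// ler_wpM2l// [leLHS](_ : _ = a * (a ^+ N * (b ^+ N * b)))%R; last ring.
    by rewrite ler_piMl// !mulr_ge0.
  rewrite [leLHS](_ : _ = (a * (b * b ^+ N)) * (a ^+ N * c))%R; last ring.
  by rewrite ler_piMl ?mulr_ge0// mulr_ile1 ?mulr_ge0// mulr_ile1.
by apply: lerD; rewrite ler_wpM2r.
Qed.

(** Bernoulli's inequality turns the power [2 ^ n] in [grid_mass_diag] into a linear expression,
    whose limit is read off from the derivative of [p] at 0. *)
Lemma killed_diag_ge h i : (0 < h)%R -> i \in G ->
  (1 + h * q i i <= K G h i i)%R.
Proof.
move=> h0 iG.
have L : (1 + (2 ^ n)%:R * (p (h / (2 ^ n)%:R) i i - (i == i)%:R))%R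
    @[n --> \oo] --> (1 + h * q i i)%R.
  by apply: cvgD; [exact: cvg_cst|exact: qmatrix_cvg_dyadic].
apply: ler_cvg_to L (grid_mass_cvg X_markov uG (ltW h0) iG iG) _.
near=> n; apply: le_trans (grid_mass_diag _ _ iG).
have hn0 : (0 <= h / (2 ^ n)%:R)%R by rewrite divr_ge0 ?ltW.
apply: le_trans (bernoulli_ineq _ _).
  by rewrite eqxx -[(_ - 1)%R]opprB mulrN.
by rewrite transition_ge0 (transition_le1 X_markov).
Unshelve. all: by end_near. Qed.

Lemma killed_offdiag_ge h i j : (0 < h)%R -> i \in G -> j \in G -> i != j ->
  (h * q i j * (1 + (h * q i i + h * q j j)) <= K G h i j)%R.
Proof.
move=> h0 iG jG ij.
have L : ((2 ^ n)%:R * (p (h / (2 ^ n)%:R) i j - (i == j)%:R) *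
    (1 + ((2 ^ n)%:R * (p (h / (2 ^ n)%:R) i i - (i == i)%:R) +
          (2 ^ n)%:R * (p (h / (2 ^ n)%:R) j j - (j == j)%:R))))%R
    @[n --> \oo] --> (h * q i j * (1 + (h * q i i + h * q j j)))%R.
  apply: cvgM; first exact: qmatrix_cvg_dyadic.
  apply: cvgD; first exact: cvg_cst.
  by apply: cvgD; exact: qmatrix_cvg_dyadic.
apply: ler_cvg_to L (grid_mass_cvg X_markov uG (ltW h0) iG jG) _.
near=> n => /=; have hn0 : (0 <= h / (2 ^ n)%:R)%R by rewrite divr_ge0 ?ltW.
apply: le_trans (grid_mass_offdiag _ hn0 iG jG ij).
rewrite (negbTE ij) subr0 !eqxx ler_wpM2l ?mulr_ge0 ?transition_ge0//.
have := transition_le1 X_markov i i hn0; have := transition_le1 X_markov j j hn0.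
have := transition_ge0 X P (h / (2 ^ n)%:R) i i.
have := transition_ge0 X P (h / (2 ^ n)%:R) j j.
set a := p _ i i; set b := p _ j j => b0 a0 b1 a1.
apply: le_trans (bernoulli_ineq _ _); last by rewrite mulr_ge0// mulr_ile1.
(* This gives [1 - a * b <= (1 - a) + (1 - b)], which separates the two waiting factors after
   Bernoulli's inequality. *)
have ab : (0 <= (1 - a) * (1 - b))%R by rewrite mulr_ge0 ?subr_ge0.
by rewrite lerD2l -mulrDr -mulrN ler_wpM2l// mulr1n; lra.
Unshelve. all: by end_near. Qed.

(** Confinement to [G] does not alter the derivative at 0: the killed mass lies below [p] and above
    the bounds of [killed_diag_ge] and [killed_offdiag_ge], and all of these have slope [q i j]. *)
Lemma killed_cvg0 i j : i \in G -> j \in G ->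
  ((K G h i j - (i == j)%:R) / h)%R @[h --> 0%R^'+] --> q i j.
Proof.
move=> iG jG; have [<-|ij] := eqVneq i j.
  apply: (squeeze_cvgr _ (cvg_cst (q i i)) (@qmatrix_cvg i i)); near=> h.
  have h0 : (0 < h)%R by [].
  rewrite eqxx ler_pdivlMr// ler_pM2r ?invr_gt0//; apply/andP; split.
    by have := killed_diag_ge h0 iG; rewrite mulr1n; lra.
  by rewrite lerD2r (killed_le_transition X_markov)// ltW.
have hcvg : h @[h --> (0 : R)%R^'+] --> (0 : R)%R by exact: cvg_at_right_filter.
have L : (q i j * (1 + h * (q i i + q j j)))%R @[h --> 0%R^'+] --> q i j.
  rewrite -[X in _ --> X]mulr1 -{2}[1%R]addr0 -[X in (1 + X)%R](mul0r (q i i + q j j)%R).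
  apply: cvgM; first exact: cvg_cst.
  by apply: cvgD; [exact: cvg_cst|apply: cvgM => //; exact: cvg_cst].
apply: (squeeze_cvgr _ L (@qmatrix_cvg i j)); near=> h.
have h0 : (0 < h)%R by [].
rewrite (negbTE ij) !subr0 ler_pdivlMr// ler_pM2r ?invr_gt0//.
apply/andP; split; last by rewrite (killed_le_transition X_markov)// ltW.
apply: le_trans (killed_offdiag_ge h0 iG jG ij).
by rewrite le_eqVlt; apply/orP; left; apply/eqP; ring.
Unshelve. all: by end_near. Qed.

Lemma killed_increment t h i j : (0 <= t)%R -> (0 <= h)%R -> j \in G ->
  (K G (t + h) i j - K G t i j =
   \sum_(m <- G) K G t i m * (K G h m j - (m == j)%:R))%R.
Proof.
move=> t0 h0 jG; rewrite (killed_semigroup X_markov uG)//.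
rewrite -[in X in (_ - X = _)%R](sum_seq_delta (K G t i) jG) -sumrB.
by apply: eq_bigr => m _; rewrite mulrBr.
Qed.

Lemma killed_le1 A t i j : (0 <= t)%R -> (killed X P A t i j <= 1)%R.
Proof.
move=> t0; apply: le_trans (killed_le_transition X_markov A i j t0) _.
exact: (transition_le1 X_markov).
Qed.

Lemma killed_right_derivative t i j : (0 <= t)%R -> j \in G ->
  ((K G (t + h) i j - K G t i j) / h)%R @[h --> 0%R^'+]
  --> (\sum_(m <- G) K G t i m * q m j)%R.
Proof.
move=> t0 jG.
have : (\sum_(m <- G) K G t i m * ((K G h m j - (m == j)%:R) / h))%R
    @[h --> 0%R^'+] --> (\sum_(m <- G) K G t i m * q m j)%R.
  apply: cvg_sum_seq => m mG; apply: cvgM; first exact: cvg_cst.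
  exact: killed_cvg0.
apply: cvg_trans; apply: near_eq_cvg; near=> h.
have h0 : (0 < h)%R by [].
rewrite killed_increment//.
rewrite mulr_suml; apply: eq_bigr => m _.
by rewrite mulrA.
Unshelve. all: by end_near. Qed.

(** The increment over the last [h] is a sum of difference quotients at 0 multiplied by [h], with
    coefficients at time [t - h] that lie in [0, 1]; so no regularity in [t] is presupposed. *)
Lemma killed_left_continuous t i j : (0 < t)%R -> j \in G ->
  K G (t - h)%R i j @[h --> 0%R^'+] --> K G t i j.
Proof.
move=> t0 jG; apply/cvgrPdist_le => e e0.
have : (\sum_(m <- G) `|(K G h m j - (m == j)%:R) / h| * h)%R
    @[h --> (0 : R)%R^'+] --> (\sum_(m <- G) `|q m j| * 0)%R.
  apply: cvg_sum_seq => m mG; apply: cvgM; last exact: cvg_at_right_filter.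
  by apply: cvg_norm; exact: killed_cvg0.
rewrite big1 => [|m _]; last by rewrite mulr0.
move/cvgrPdist_le => /(_ _ e0) H; near=> h.
have h0 : (0 < h)%R by [].
have ht : (h <= t)%R by near: h; apply: nbhs_right_le.
have := killed_increment i (t := (t - h)%R) (h := h) _ _ jG.
rewrite subrK subr_ge0 => /(_ ht (ltW h0)) ->.
have : (`|0 - \sum_(m <- G) `|(K G h m j - (m == j)%:R) / h| * h| <= e)%R.
  by near: h.
rewrite sub0r normrN; apply: le_trans.
apply: le_trans (ler_norm_sum _ _ _) _; apply: le_trans _ (ler_norm _).
apply: ler_sum => m _; rewrite normrM ger0_norm ?killed_ge0//.
rewrite normrM [X in (_ * X * _)%R]gtr0_norm ?invr_gt0// divfK ?gt_eqF//.
by rewrite ler_piMl// killed_le1// subr_ge0.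
Unshelve. all: by end_near. Qed.

Lemma killed_right_continuous t i j : (0 <= t)%R -> j \in G ->
  K G (t + h)%R i j @[h --> 0%R^'+] --> K G t i j.
Proof.
move=> t0 jG.
have : (K G t i j + (K G (t + h) i j - K G t i j) / h * h)%R @[h --> (0 : R)%R^'+]
    --> (K G t i j + (\sum_(m <- G) K G t i m * q m j) * 0)%R.
  apply: cvgD; first exact: cvg_cst.
  apply: cvgM; last exact: cvg_at_right_filter.
  exact: killed_right_derivative.
rewrite mulr0 addr0; apply: cvg_trans; apply: near_eq_cvg; near=> h.
by rewrite divfK ?gt_eqF// addrC subrK.
Unshelve. all: by end_near. Qed.

(** The increment formula starts at [t - h], so its coefficients move with [h]; left continuity
    brings them to their values at [t]. *)
Lemma killed_left_derivative t i j : (0 < t)%R -> j \in G ->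
  ((K G (t - h) i j - K G t i j) / - h)%R @[h --> 0%R^'+]
  --> (\sum_(m <- G) K G t i m * q m j)%R.
Proof.
move=> t0 jG.
have : (\sum_(m <- G) K G (t - h) i m * ((K G h m j - (m == j)%:R) / h))%R
    @[h --> 0%R^'+] --> (\sum_(m <- G) K G t i m * q m j)%R.
  apply: cvg_sum_seq => m mG; apply: cvgM; first exact: killed_left_continuous.
  exact: killed_cvg0.
apply: cvg_trans; apply: near_eq_cvg; near=> h.
have h0 : (0 < h)%R by [].
have ht : (h <= t)%R by near: h; apply: nbhs_right_le.
have := killed_increment i (t := (t - h)%R) (h := h) _ _ jG.
rewrite subrK subr_ge0 => /(_ ht (ltW h0)) incr.
rewrite invrN mulrN -mulNr opprB incr mulr_suml; apply: eq_bigr => m _.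
by rewrite mulrA.
Unshelve. all: by end_near. Qed.

Lemma killed_is_derive (t : R) (i j : S) : (0 < t)%R -> j \in G ->
  is_derive t (1%R : R) (fun s : R => K G s i j)
    (\sum_(m <- G) K G t i m * q m j)%R.
Proof.
move=> t0 jG.
pose f h := (h^-1 * (K G (h * 1 + t) i j - K G t i j))%R.
pose l := (\sum_(m <- G) K G t i m * q m j)%R.
have fr : f h @[h --> 0%R^'+] --> l.
  apply: cvg_trans (killed_right_derivative (i := i) (ltW t0) jG).
  apply: near_eq_cvg; near=> h.
  by rewrite /f mulr1 [(h + t)%R]addrC mulrC.
have fl : f h @[h --> 0%R^'-] --> l.
  apply/cvg_at_leftNP; rewrite oppr0.
  apply: cvg_trans (killed_left_derivative (i := i) t0 jG).
  apply: near_eq_cvg; near=> h => /=.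
  by rewrite /f mulr1 [(- h + t)%R]addrC mulrC.
have H : f h @[h --> 0%R^'] --> l by exact: (@cvg_at_right_left_dnbhs _ R^o).
by split; [apply/cvg_ex; eexists; exact: H|exact: cvg_lim H].
Unshelve. all: by end_near. Qed.

End finite_set.

End forward_equation.

(** * Sums over countable sets *)

Section enumeration.
Context (R : realType) (S : countType).

(** The states of code below [n]. These nested finite lists turn unordered sums into limits of
    sequences. *)
Definition enum_upto (n : nat) : seq S := pmap (@pickle_inv S) (iota 0 n).

Lemma enum_upto_uniq n : uniq (enum_upto n).
Proof. by apply: (pmap_uniq (@pickle_invK S)); exact: iota_uniq. Qed.

Lemma mem_enum_upto n i : (i \in enum_upto n) = (pickle i < n)%N.
Proof.
rewrite mem_pmap; apply/mapP/idP => [[k]|i_n].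
  rewrite mem_iota add0n leq0n => /= kn Si.
  by have := @pickle_invK S k; rewrite -Si /= => ->.
by exists (pickle i); rewrite ?mem_iota ?add0n ?pickleK_inv.
Qed.

Lemma enum_upto_cat n m : (n <= m)%N ->
  exists s, enum_upto m = enum_upto n ++ s.
Proof.
move=> nm; exists (pmap (@pickle_inv S) (iota n (m - n))).
by rewrite -pmap_cat -[in RHS](add0n n) -iotaD subnKC.
Qed.

Lemma fsets_subset_seq (A F : set S) : fsets A F ->
  exists r : seq S, [/\ uniq r, F = [set` r] & forall i, i \in r -> A i].
Proof.
move=> [/finite_seqP[r Fr] FA]; exists (undup r); split.
- exact: undup_uniq.
- by rewrite Fr; apply/seteqP; split=> i /=; rewrite mem_undup.
- by move=> i; rewrite mem_undup => ir; apply: FA; rewrite Fr.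
Qed.

Lemma sum_seq_le_esum (A : set S) (a : S -> \bar R) (r : seq S) :
  uniq r -> \sum_(i <- r | i \in A) a i <= \esum_(i in A) a i.
Proof.
move=> ur; apply: esum_ge; exists [set` [seq i <- r | i \in A]].
  split; first by apply/finite_seqP; exists [seq i <- r | i \in A].
  by move=> i /=; rewrite mem_filter => /andP[/set_mem].
by rewrite -fsbig_seq ?filter_uniq// big_filter.
Qed.

(** Monotone convergence in which the terms and the range of summation grow with the same [n]. The
    masses killed outside the [n]-th finite set are summed over that very set, which calls for this
    diagonal form. *)
Lemma esum_enum_cvg (A : set S) (a : nat -> S -> \bar R) (b : S -> \bar R) :
  (forall n i, A i -> 0 <= a n i) ->
  (forall i, A i -> {homo a^~ i : n m / (n <= m)%N >-> n <= m}) ->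
  (forall i, A i -> a n i @[n --> \oo] --> b i) ->
  \sum_(i <- enum_upto n | i \in A) a n i @[n --> \oo] --> \esum_(i in A) b i.
Proof.
move=> a0 ah ab.
have a_le_b n i : A i -> a n i <= b i.
  move=> Ai; apply: (cvge_to_ge (ab i Ai)); near=> m.
  by apply: ah => //; near: m; exact: nbhs_infty_ge.
have s_nd : {homo (fun n => \sum_(i <- enum_upto n | i \in A) a n i) :
    n m / (n <= m)%N >-> n <= m}.
  move=> n m nm; have [s ->] := enum_upto_cat nm.
  rewrite big_cat/= -[leLHS]adde0; apply: leeD.
    by apply: lee_sum => i /set_mem Ai; exact: ah.
  by apply: sume_ge0 => i /set_mem Ai; exact: a0.
suff <- : ereal_sup (range (fun n => \sum_(i <- enum_upto n | i \in A) a n i)) =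
    \esum_(i in A) b i by exact: ereal_nondecreasing_cvgn.
apply/eqP; rewrite eq_le; apply/andP; split.
  apply: ge_ereal_sup => _ [n _ <-].
  apply: le_trans (sum_seq_le_esum _ _ (enum_upto_uniq n)).
  by apply: lee_sum => i /set_mem Ai; exact: a_le_b.
apply: ge_ereal_sup => _ [F AF <-].
have [r [ur -> rA]] := fsets_subset_seq AF.
rewrite -fsbig_seq//.
have rA' i : i \in r -> i \in A by move=> ir; apply/mem_set/rA.
have : \sum_(i <- r | i \in A) a n i @[n --> \oo] --> \sum_(i <- r | i \in A) b i.
  apply: cvg_nnesum => i /set_mem Ai; last exact: ab.
  by apply: nearW => n; exact: a0.
have sumA (c : S -> \bar R) : \sum_(i <- r | i \in A) c i = \sum_(i <- r) c i.
  rewrite [in RHS]big_seq [in LHS]big_seq_cond; apply: eq_bigl => i.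
  by case ir : (i \in r) => //=; exact: rA'.
rewrite sumA; under eq_fun do rewrite sumA.
move/cvge_to_le; apply; near=> n.
(* For [n] large, [enum_upto n] contains the finite set [r]; its other elements contribute
   nonnegative terms. *)
apply: (@le_trans _ _ (\sum_(i <- enum_upto n | i \in A) a n i)); last first.
  by apply: ereal_sup_ubound; exists n.
have nr : {subset r <= enum_upto n}.
  move=> i ir; rewrite mem_enum_upto.
  apply: (@leq_ltn_trans (\max_(j <- r) pickle j)).
    by rewrite (big_rem i)//= leq_max leqnn.
  by near: n; exact: nbhs_infty_gt.
rewrite -[leRHS]big_filter [leRHS](perm_big
  (r ++ [seq i <- enum_upto n | (i \in A) && (i \notin r)])) /=.
  rewrite big_cat/= leeDl// big_filter sume_ge0// => i /andP[/set_mem Ai _].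
  exact: a0.
apply: uniq_perm.
- exact/filter_uniq/enum_upto_uniq.
- rewrite cat_uniq ur filter_uniq ?enum_upto_uniq//= andbT.
  by apply/hasPn => i /=; rewrite mem_filter => /andP[/andP[_ ir] _].
- move=> i; rewrite mem_cat !mem_filter.
  by have [ir|] := boolP (i \in r); rewrite /= ?andbT// nr// rA'.
Unshelve. all: by end_near. Qed.

Lemma esum_enum (A : set S) (b : S -> \bar R) : (forall i, A i -> 0 <= b i) ->
  \sum_(i <- enum_upto n | i \in A) b i @[n --> \oo] --> \esum_(i in A) b i.
Proof.
move=> b0; apply: (esum_enum_cvg (a := fun=> b)).
- by move=> _; exact: b0.
- by move=> i _ n m _; exact: lexx.
- by move=> i _; exact: cvg_cst.
Qed.

End enumeration.
Arguments enum_upto {S}.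

Lemma esum_trivIset (R : realType) (T I : choiceType) (K : set I)
    (F : I -> set T) (a : T -> \bar R) :
  trivIset K F -> (forall k x, K k -> F k x -> 0 <= a x) ->
  \esum_(x in \bigcup_(k in K) F k) a x = \esum_(k in K) \esum_(x in F k) a x.
Proof.
move=> tF a0; rewrite esum_esum//.
rewrite (@reindex_esum _ _ _ (K `*`` F) (\bigcup_(k in K) F k) snd)//.
split.
- by move=> [k x] /= [Kk Fx]; exists k.
- move=> [k x] [l y] /set_mem[/= Kk Fx] /set_mem[/= Kl Fy] xy.
  rewrite -xy in Fy *; congr (_, _); apply: tF => //.
  by exists x.
- by move=> x [k Kk Fx]; exists (k, x).
Qed.

(** * The chain started from the initial distribution *)

Section initial_distribution.
Context (R : realType) (d : measure_display) (Omega : measurableType d)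
  (S : countType) (P : S -> probability Omega R) (D : set S) (mu : S -> R).
Context (mu_distribution : distribution_off D mu).

(** A countable mixture of probabilities is a measure; countable additivity and monotonicity of
    [P_init] are drawn from this representation. *)
Lemma P_init_measure :
  exists m : {measure set Omega -> \bar R}, m = P_init P D mu :> (_ -> _).
Proof.
have [mu0 muD _] := mu_distribution.
(* A code that decodes to no state contributes the zero measure; a state of [D] contributes nothing
   because [mu] vanishes there. *)
pose m (k : nat) : {measure set Omega -> \bar R} :=
  if pickle_inv k is Some i then mscale (NngNum (mu0 i)) (P i) else mzero.
exists (mseries m 0); apply/funext => A.
rewrite /mseries /P_init.
have mu_P0 i : (~` D) i -> 0 <= (mu i)%:E * P i A by rewrite mule_ge0 ?lee_fin.
apply/cvg_lim => //; move: (esum_enum mu_P0); apply: cvg_trans.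
apply: near_eq_cvg; near=> n.
rewrite [LHS]big_mkcond /enum_upto big_pmap /index_iota subn0; apply: eq_bigr => k _.
rewrite /m; case: pickle_inv => //= i; rewrite /mscale/=.
case: ifPn => // /negP iD; rewrite muD ?mul0e//.
by apply: contrapT => nDi; apply: iD; exact/mem_set.
Unshelve. all: by end_near. Qed.

Lemma P_init_ge0 (A : set Omega) : 0 <= P_init P D mu A.
Proof. by have [m <-] := P_init_measure. Qed.

Lemma P_init_setT : P_init P D mu setT = 1.
Proof.
have [mu0 muD <-] := mu_distribution; apply: eq_esum => i _.
by rewrite probability_setT mule1.
Qed.

Lemma P_init_fin_num (A : set Omega) : measurable A ->
  P_init P D mu A \is a fin_num.
Proof.
move=> mA; have [m mE] := P_init_measure; rewrite ge0_fin_numE ?P_init_ge0//.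
apply: (@le_lt_trans _ _ 1); last by rewrite ltry.
by rewrite -P_init_setT -mE le_measure ?inE.
Qed.

Lemma P_init_esum (f : Omega -> S) (B : set S) (A : set Omega) :
  measurable A -> (forall j, measurable (f @^-1` [set j])) ->
  P_init P D mu (A `&` f @^-1` B) =
  \esum_(j in B) P_init P D mu (A `&` f @^-1` [set j]).
Proof.
move=> mA mf; have [m <-] := P_init_measure.
have -> : A `&` f @^-1` B =
    \bigcup_k (if pickle_inv k is Some j then
                 if j \in B then A `&` f @^-1` [set j] else set0 else set0).
  apply/seteqP; split=> w /=.
    move=> [Aw Bw]; exists (pickle (f w)) => //.
    by rewrite pickleK_inv mem_set.
  move=> [k _]; case: pickle_inv => // j; case: ifPn => // /set_mem Bj.
  by move=> /= [Aw ->].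
rewrite measure_bigcup//=; last 2 first.
- move=> k _; case: pickle_inv => // j; case: ifPn => // _.
  exact: measurableI.
- move=> k l _ _ [w /=]; have := @pickle_invK S k; have := @pickle_invK S l.
  case: pickle_inv => [j|] /=; last by move=> _ _ [].
  move=> <-; case: pickle_inv => [j'|] /=; last by move=> _ [].
  by move=> <-; case: ifPn => _ []; case: ifPn => _ // [_ <-] [_ <-].
apply/cvg_lim => //.
have mf0 j : B j -> 0 <= m (A `&` f @^-1` [set j]) by [].
move: (esum_enum mf0); apply: cvg_trans.
apply: near_eq_cvg; near=> n.
rewrite [LHS]big_mkcond /enum_upto big_pmap /index_iota subn0.
apply: eq_big => [k|k _]; first by rewrite in_setT.
case: pickle_inv => [j|] /=; last by rewrite measure0.
by case: ifPn => // _; rewrite measure0.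
Unshelve. all: by end_near. Qed.

End initial_distribution.

(** * Occupation times *)

Lemma ler_sum_sub_seq (R : numDomainType) (T : eqType) (r s : seq T)
    (f : T -> R) : uniq r -> uniq s -> {subset r <= s} ->
  (forall i, 0 <= f i)%R -> (\sum_(i <- r) f i <= \sum_(i <- s) f i)%R.
Proof.
move=> ur us rs f0; rewrite (perm_big [seq i <- s | i \in r]) /=.
  rewrite big_filter big_mkcond; apply: ler_sum => i _; by case: ifP.
apply: uniq_perm => //; first exact: filter_uniq.
by move=> i; rewrite mem_filter; case ir : (i \in r) => //=; rewrite rs.
Qed.

Lemma is_derive_sum_seq (R : realType) (T : eqType) (r : seq T)
    (f : T -> R -> R) (df : T -> R) (x : R) :
  (forall i, i \in r -> is_derive x (1%R : R) (f i) (df i)) ->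
  is_derive x (1%R : R) (fun s : R => (\sum_(i <- r) f i s)%R)
    (\sum_(i <- r) df i)%R.
Proof.
elim: r => [_|i r IH fr].
  rewrite big_nil (_ : (fun s => _) = cst 0%R); first exact: is_derive_cst.
  by apply/funext => s; rewrite big_nil.
rewrite big_cons (_ : (fun s => _) =
    (f i \+ (fun s => \sum_(j <- r) f j s))%R); last first.
  by apply/funext => s; rewrite big_cons.
have fi := fr i (mem_head _ _).
have fs : is_derive x (1%R : R) (fun s : R => (\sum_(i <- r) f i s)%R)
    (\sum_(i <- r) df i)%R.
  by apply: IH => j jr; apply: fr; rewrite in_cons jr orbT.
exact: is_deriveD.
Qed.

Lemma Rintegral_lin_seq (R : realType) (T : eqType) (r : seq T)
    (f : T -> R -> R) (c : T -> R) (a b : R) :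
  (forall i, i \in r -> {within `[a, b], continuous (f i)}) ->
  (\int[lebesgue_measure]_(s in `[a, b]) (\sum_(i <- r) f i s * c i) =
   \sum_(i <- r) (\int[lebesgue_measure]_(s in `[a, b]) f i s) * c i)%R /\
  {within `[a, b], continuous (fun s => \sum_(i <- r) f i s * c i)%R}.
Proof.
elim: r => [_|i r IH fr].
  rewrite (_ : (fun s => _) = cst 0%R); last first.
    by apply/funext => s; rewrite big_nil.
  by rewrite big_nil Rintegral_cst// mul0r; split=> // x; exact: cvg_cst.
have fi := fr i (mem_head _ _).
have [IH1 IH2] : _ := IH (fun j jr => fr j (mem_behead (s := i :: r) jr)).
have int g : {within `[a, b], continuous g} ->
    lebesgue_measure.-integrable `[a, b] (EFin \o g).
  by move=> cg; apply: continuous_compact_integrable => //; exact: segment_compact.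
have fic : {within `[a, b], continuous (fun s => f i s * c i)%R}.
  by move=> x; apply: cvgM; [exact: fi|exact: cvg_cst].
rewrite (_ : (fun s => _) =
    (fun s => f i s * c i + \sum_(j <- r) f j s * c j)%R); last first.
  by apply/funext => s; rewrite big_cons.
split; last by move=> x; apply: cvgD; [exact: fic|exact: IH2].
rewrite big_cons -IH1 -RintegralZr//; last exact: int.
by rewrite -RintegralD//; exact: int.
Qed.

Section flow.
Context (R : realType) (d : measure_display) (Omega : measurableType d)
  (S : countType) (X : R -> Omega -> S) (P : S -> probability Omega R)
  (q : S -> S -> R) (mu : S -> R).
Context (X_markov : markov_chain X P) (X_qmatrix : is_qmatrix X P q).
Context (mu_ge0 : forall i, (0 <= mu i)%R).

(* [flow G t j] is the mass at [j], at time [t], of the paths that started from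
   [mu] and have stayed in [G]; [occ] is the corresponding occupation time. *)
Definition flow (G : seq S) (t : R) (j : S) : R :=
  (\sum_(i <- G) mu i * killed X P [set` G] t i j)%R.

Definition occ (G : seq S) (t : R) (j : S) : R :=
  (\int[lebesgue_measure]_(s in `[0%R, t]) flow G s j)%R.

Lemma flow_ge0 G t j : (0 <= flow G t j)%R.
Proof. by apply: sumr_ge0 => i _; rewrite mulr_ge0 ?mu_ge0 ?killed_ge0. Qed.

Lemma occ_ge0 G t j : (0 <= occ G t j)%R.
Proof. by apply: Rintegral_ge0 => s _; exact: flow_ge0. Qed.

Lemma flow_sub G H t j : uniq G -> uniq H -> {subset G <= H} -> (0 <= t)%R ->
  (flow G t j <= flow H t j)%R.
Proof.
move=> uG uH GH t0.
apply: (@le_trans _ _ (\sum_(i <- G) mu i * killed X P [set` H] t i j)%R).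
  apply: ler_sum => i _; rewrite ler_wpM2l ?mu_ge0//.
  exact: (killed_subset X_markov).
by apply: ler_sum_sub_seq => // i; rewrite mulr_ge0 ?mu_ge0 ?killed_ge0.
Qed.

Section finite_set.
Context (G : seq S) (uG : uniq G).

Lemma flow0 j : j \in G -> flow G 0 j = mu j.
Proof.
move=> jG; rewrite /flow -(sum_seq_delta uG mu jG) big_seq [RHS]big_seq.
by apply: eq_bigr => i iG; rewrite (killed0 X_markov).
Qed.

Lemma flow_is_derive (t : R) j : (0 < t)%R -> j \in G ->
  is_derive t (1%R : R) (fun s : R => flow G s j)
    (\sum_(m <- G) flow G t m * q m j)%R.
Proof.
move=> t0 jG.
have -> : (\sum_(m <- G) flow G t m * q m j =
    \sum_(i <- G) mu i * \sum_(m <- G) killed X P [set` G] t i m * q m j)%R.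
  under eq_bigr do rewrite mulr_suml.
  rewrite exchange_big; apply: eq_bigr => i _; rewrite mulr_sumr.
  by apply: eq_bigr => m _; rewrite mulrA.
apply: is_derive_sum_seq => i _; apply: is_deriveZ.
exact: (killed_is_derive X_markov X_qmatrix uG).
Qed.

Lemma flow_right_continuous0 j : j \in G ->
  flow G h j @[h --> 0%R^'+] --> flow G 0 j.
Proof.
move=> jG; apply: cvg_sum_seq => i _; apply: cvgM; first exact: cvg_cst.
have := killed_right_continuous X_markov X_qmatrix uG (i := i) (lexx 0%R) jG.
by apply: cvg_trans; apply: near_eq_cvg; near=> h; rewrite add0r.
Unshelve. all: by end_near. Qed.

Lemma flow_continuous (t : R) j : (0 < t)%R -> j \in G ->
  {for t, continuous (fun s : R => flow G s j)}.
Proof.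
move=> t0 jG; apply/differentiable_continuous/derivable1_diffP.
by have [] := flow_is_derive t0 jG.
Qed.

Lemma flow_within_continuous (t : R) j : (0 < t)%R -> j \in G ->
  {within `[0%R, t], continuous (fun s : R => flow G s j)}.
Proof.
move=> t0 jG; apply/continuous_within_itvP => //; split.
- by move=> x; rewrite in_itv/= => /andP[x0 _]; exact: flow_continuous.
- exact: flow_right_continuous0.
- by apply: cvg_at_left_filter; exact: flow_continuous.
Qed.

Lemma flow_integrable (t : R) j : (0 < t)%R -> j \in G ->
  lebesgue_measure.-integrable `[0%R, t] (EFin \o (fun s : R => flow G s j)).
Proof.
move=> t0 jG; apply: continuous_compact_integrable.
  exact: segment_compact.
exact: flow_within_continuous.
Qed.

(** The forward equation is integrated because occupation times, unlike derivatives, increase with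
    [G] and so have limits. *)
Lemma flow_forward (t : R) j : (0 <= t)%R -> j \in G ->
  flow G t j = (mu j + \sum_(m <- G) occ G t m * q m j)%R.
Proof.
rewrite le_eqVlt => /predU1P[<-|t0] jG.
  rewrite flow0// big1 ?addr0// => m _.
  by rewrite /occ set_itv1 Rintegral_set1 mul0r.
have [intE cont] := @Rintegral_lin_seq _ _ G (fun m s => flow G s m)
  (fun m => q m j) 0%R t (fun m mG => flow_within_continuous t0 mG).
have FTC : (\int[lebesgue_measure]_(s in `[0%R, t])
    (\sum_(m <- G) flow G s m * q m j)%:E = (flow G t j)%:E - (flow G 0 j)%:E).
  apply: (continuous_FTC2 (F := fun s : R => flow G s j)) => //.
    split; last 2 first.
    - exact: flow_right_continuous0.
    - by apply: cvg_at_left_filter; exact: flow_continuous.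
    by move=> x; rewrite in_itv/= => /andP[x0 _]; have [] := flow_is_derive x0 jG.
  move=> x; rewrite in_itv/= => /andP[x0 _].
  by have [_ dE] := flow_is_derive x0 jG; rewrite derive1E dE.
rewrite -intE /Rintegral FTC/= flow0//; ring.
Qed.

Lemma flow_sum_forward (t : R) (B : set S) : (0 <= t)%R ->
  (\sum_(j <- G | j \in B) flow G t j = \sum_(j <- G | j \in B) mu j +
   \sum_(m <- G) occ G t m * \sum_(j <- G | j \in B) q m j)%R.
Proof.
move=> t0; transitivity (\sum_(j <- G | j \in B)
    (mu j + \sum_(m <- G) occ G t m * q m j))%R.
  rewrite big_seq_cond [RHS]big_seq_cond.
  by apply: eq_bigr => j /andP[jG _]; exact: flow_forward.
rewrite big_split/=; congr (_ + _)%R; rewrite exchange_big/=.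
by apply: eq_bigr => m _; rewrite mulr_sumr.
Qed.

End finite_set.

Lemma occ_sub G H (t : R) j : uniq G -> uniq H -> {subset G <= H} ->
  j \in G -> (0 <= t)%R -> (occ G t j <= occ H t j)%R.
Proof.
move=> uG uH GH jG; rewrite le_eqVlt => /predU1P[<-|t0].
  by rewrite /occ set_itv1 !Rintegral_set1.
apply: le_Rintegral => //.
- exact: flow_integrable.
- by apply: flow_integrable => //; exact: GH.
- by move=> s /=; rewrite in_itv/= => /andP[s0 _]; exact: flow_sub.
Qed.

End flow.

(** * Non-explosion and exhaustion by finite sets *)

Lemma jump_time_ge0 (R : realType) (Omega : Type) (S : countType)
    (X : R -> Omega -> S) n w : 0 <= jump_time X n w.
Proof.
elim: n => [|n IH] //=; apply: le_ereal_inf_tmp => _ [s [Js _] <-].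
exact: le_trans IH (ltW Js).
Qed.

(** Each jump adds at most one state to those already visited. Finiteness is expressed by a bound on
    codes, to match [enum_upto]. *)
Lemma finite_before_jump (R : realType) (Omega : Type) (S : countType)
    (X : R -> Omega -> S) n w :
  exists N, forall s, (0 <= s)%R -> s%:E < jump_time X n w ->
    (pickle (X s w) < N)%N.
Proof.
elim: n => [|n [N IH]].
  by exists 0%N => s s0; rewrite /= lte_fin ltNge s0.
have J0 := jump_time_ge0 X n w.
(* Between two successive jump times the path keeps its value at the first of them, since a
   different value would lower the infimum that defines the second. *)
exists (maxn N (pickle (X (fine (jump_time X n w)) w)).+1) => s s0.
have [sJ _|Js sJ] := ltP s%:E (jump_time X n w).
  by rewrite (leq_trans (IH _ s0 sJ))// leq_maxl.
suff -> : X s w = X (fine (jump_time X n w)) w by rewrite leq_maxr.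
have Jfin : jump_time X n w \is a fin_num.
  by rewrite ge0_fin_numE// (le_lt_trans Js)// ltry.
move: Js; rewrite le_eqVlt => /predU1P[->//|Js].
apply: contrapT => Xs; move: sJ; rewrite /= ltNge => /negP; apply.
by apply: ereal_inf_lbound; exists s.
Qed.

Lemma stay_finite (R : realType) (Omega : Type) (S : countType)
    (X : R -> Omega -> S) w : ereal_sup (range (fun n => jump_time X n w)) = +oo ->
  forall t, (0 <= t)%R -> exists N, forall s, (0 <= s <= t)%R ->
    (pickle (X s w) < N)%N.
Proof.
move=> supJ t t0; have : t%:E < ereal_sup (range (fun n => jump_time X n w)).
  by rewrite supJ ltry.
move=> /ereal_sup_gt[_ [n _ <-] tJ].
have [N XN] := finite_before_jump X n w.
exists N => s /andP[s0 st]; apply: XN => //.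
by apply: le_lt_trans tJ; rewrite lee_fin.
Qed.

Definition exhaust (S : countType) (A : set S) (n : nat) : seq S :=
  [seq x <- enum_upto n | x \in A].

Lemma exhaust_uniq (S : countType) (A : set S) n : uniq (exhaust A n).
Proof. exact/filter_uniq/enum_upto_uniq. Qed.

Lemma mem_exhaust (S : countType) (A : set S) n x :
  (x \in exhaust A n) = (x \in A) && (pickle x < n)%N.
Proof. by rewrite mem_filter mem_enum_upto. Qed.

Lemma exhaust_sub (S : countType) (A : set S) n m : (n <= m)%N ->
  {subset exhaust A n <= exhaust A m}.
Proof.
by move=> nm x; rewrite !mem_exhaust => /andP[-> /leq_trans]; exact.
Qed.

(** * Passage to the limit along the exhaustion *)

Section limits.
Context (R : realType) (d : measure_display) (Omega : measurableType d)
  (S : countType) (X : R -> Omega -> S) (P : S -> probability Omega R)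
  (q : S -> S -> R) (D : set S) (mu : S -> R).
Context (X_markov : markov_chain X P) (X_qmatrix : is_qmatrix X P q)
  (X_non_explosive : non_explosive X P) (mu_distribution : distribution_off D mu).

Let mu0 i : (0 <= mu i)%R.
Proof. by case: mu_distribution. Qed.

(** Non-explosion enters here: almost every path that stays in [A] up to [t] stays in one of the
    finite sets, and continuity from below applies. *)
Lemma killed_exhaust_cvg (A : set S) (t : R) i j : (0 <= t)%R ->
  (killed X P [set` exhaust A n] t i j)%:E @[n --> \oo] -->
  P i (stay X A t `&` X t @^-1` [set j]).
Proof.
move=> t0; pose F n := stay X [set` exhaust A n] t `&` X t @^-1` [set j].
have mF n : measurable (F n) by exact: (measurable_stayX X_markov).
have mUF : measurable (\bigcup_n F n) by exact: bigcupT_measurable.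
have mA : measurable (stay X A t `&` X t @^-1` [set j]).
  exact: (measurable_stayX X_markov).
have -> : P i (stay X A t `&` X t @^-1` [set j]) = P i (\bigcup_n F n).
  apply/eqP; rewrite eq_le; apply/andP; split; last first.
    apply: le_measure; rewrite ?inE// => w [n _ [sw Xj]]; split=> // u ut.
    by have := sw u ut; rewrite /= mem_exhaust => /andP[/set_mem].
  have [N [mN PN0 NP]] := X_non_explosive i.
  apply: (@le_trans _ _ (P i (\bigcup_n F n) + P i N)); last by rewrite PN0 adde0.
  apply: le_trans _ (measureU2 _ _ _) => //.
  apply: le_measure; rewrite ?inE//; first exact: measurableU.
  move=> w [sw Xj].
  have [wJ|wJ] := EM (ereal_sup (range (fun n => jump_time X n w)) = +oo).
    have [n wn] := stay_finite wJ t0.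
    left; exists n => //; split=> // u ut.
    have := wn u ut; rewrite /= mem_exhaust add0r => ->.
    by rewrite andbT; apply/mem_set; have := sw u ut; rewrite add0r.
  by right; apply: NP.
under eq_fun do rewrite (killedE X_markov)//.
apply: nondecreasing_cvg_mu => //.
move=> n m nm; apply/subsetPset => w [sw Xj]; split=> // u ut.
exact/(exhaust_sub nm)/sw.
Qed.

Lemma P_init_superset (A : set S) (B : set Omega) : ~` D `<=` A ->
  \esum_(i in A) ((mu i)%:E * P i B) = P_init P D mu B.
Proof.
move=> DA; have [_ muD _] := mu_distribution.
rewrite /P_init esum_mkcond [RHS]esum_mkcond; apply: eq_esum => i _.
have [Di|nDi] := EM (D i).
  rewrite muD// mul0e [in RHS]ifF; last by apply/negP => /set_mem.
  by case: ifP.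
by rewrite !ifT//; apply/mem_set => //; exact: DA.
Qed.

Lemma flow_cvg (A : set S) (t : R) j : ~` D `<=` A -> (0 <= t)%R ->
  (flow X P mu (exhaust A n) t j)%:E @[n --> \oo] -->
  P_init P D mu (stay X A t `&` X t @^-1` [set j]).
Proof.
move=> DA t0; rewrite -(P_init_superset _ DA).
under eq_fun do rewrite /flow -sumEFin /exhaust big_filter.
apply: esum_enum_cvg.
- by move=> n i _; rewrite lee_fin mulr_ge0 ?mu0 ?killed_ge0.
- move=> i _ n m nm; rewrite lee_fin ler_wpM2l ?mu0//.
  by apply: (killed_subset X_markov) => // x; exact: exhaust_sub.
- move=> i _; under eq_fun do rewrite EFinM.
  by apply: cvgeZl => //; exact: killed_exhaust_cvg.
Qed.

Lemma flow_sum_nd (A B : set S) (t : R) : (0 <= t)%R ->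
  {homo (fun n => (\sum_(j <- exhaust A n | j \in B)
     flow X P mu (exhaust A n) t j)%R) : n m / (n <= m)%N >-> (n <= m)%R}.
Proof.
move=> t0 n m nm; apply: (@le_trans _ _ (\sum_(j <- exhaust A n | j \in B)
     flow X P mu (exhaust A m) t j)%R).
  apply: ler_sum => j _; apply: flow_sub => //; try exact: exhaust_uniq.
  exact: exhaust_sub.
rewrite -big_filter -[leRHS]big_filter; apply: ler_sum_sub_seq.
- exact/filter_uniq/exhaust_uniq.
- exact/filter_uniq/exhaust_uniq.
- move=> x; rewrite mem_filter => /andP[xB xn].
  by rewrite mem_filter xB; exact: exhaust_sub nm _ xn.
- by move=> j; exact: flow_ge0.
Qed.

Lemma flow_sum_cvg (A B : set S) (t : R) : ~` D `<=` A -> B `<=` A -> (0 <= t)%R ->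
  (\sum_(j <- exhaust A n | j \in B) flow X P mu (exhaust A n) t j)%:E
    @[n --> \oo] -->
  P_init P D mu (stay X A t `&` X t @^-1` B).
Proof.
move=> DA BA t0; rewrite (P_init_esum P mu_distribution (f := X t))//; last 2 first.
- exact: (measurable_stay X_markov).
- by move=> j; exact: (mc_measurable X_markov).
under eq_fun do rewrite -sumEFin big_filter_cond.
have -> : (fun n => \sum_(j <- enum_upto n | (j \in A) && (j \in B))
      (flow X P mu (exhaust A n) t j)%:E) =
    (fun n => \sum_(j <- enum_upto n | j \in B)
      (flow X P mu (exhaust A n) t j)%:E).
  apply/funext => n; apply: eq_bigl => j; apply: andb_idl => /set_mem Bj.
  exact/mem_set/BA.
apply: esum_enum_cvg.
- by move=> n j _; rewrite lee_fin; exact: flow_ge0.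
- move=> j _ n m nm; rewrite lee_fin; apply: flow_sub => //; try exact: exhaust_uniq.
  exact: exhaust_sub.
- by move=> j _; exact: flow_cvg.
Qed.

Lemma flow_sum_within (G : seq S) (B : set S) (t : R) : uniq G -> (0 < t)%R ->
  (\int[lebesgue_measure]_(s in `[0%R, t])
    \sum_(j <- G | j \in B) flow X P mu G s j =
  \sum_(j <- G | j \in B) occ X P mu G t j)%R /\
  {within `[0%R, t], continuous
    (fun s : R => \sum_(j <- G | j \in B) flow X P mu G s j)%R}.
Proof.
move=> uG t0.
have := @Rintegral_lin_seq R _ [seq j <- G | j \in B]
  (fun j s => flow X P mu G s j) (fun=> 1%R) 0%R t.
have -> : (fun s : R => \sum_(j <- [seq j <- G | j \in B])
    flow X P mu G s j * 1)%R =
    (fun s : R => \sum_(j <- G | j \in B) flow X P mu G s j)%R.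
  by apply/funext => s; rewrite big_filter; apply: eq_bigr => j _; rewrite mulr1.
rewrite big_filter (eq_bigr (occ X P mu G t)); last by move=> j _; rewrite mulr1.
apply=> j; rewrite mem_filter => /andP[_ jG].
exact: (flow_within_continuous X_markov X_qmatrix uG t0 jG).
Qed.

Lemma occ_sum (G : seq S) (B : set S) (t : R) : uniq G -> (0 <= t)%R ->
  (\sum_(j <- G | j \in B) occ X P mu G t j)%:E =
  \int[lebesgue_measure]_(s in `[0%R, t])
    (\sum_(j <- G | j \in B) flow X P mu G s j)%:E.
Proof.
move=> uG; rewrite le_eqVlt => /predU1P[<-|t0].
  rewrite set_itv1 integral_set1 big1// => j _.
  by rewrite /occ set_itv1 Rintegral_set1.
have [intE cont] := flow_sum_within B uG t0.
transitivity (\int[lebesgue_measure]_(s in `[0%R, t])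
    \sum_(j <- G | j \in B) flow X P mu G s j)%R%:E; first by rewrite intE.
rewrite /Rintegral fineK//; apply: integrable_fin_num => //.
by apply: continuous_compact_integrable => //; exact: segment_compact.
Qed.

Lemma flow_sum_measurable (A B : set S) (t : R) n : (0 <= t)%R ->
  measurable_fun `[0%R, t] (fun s : R =>
    (\sum_(j <- exhaust A n | j \in B) flow X P mu (exhaust A n) s j)%:E).
Proof.
rewrite le_eqVlt => /predU1P[<-|t0].
  by rewrite set_itv1; exact: measurable_fun_set1.
apply/measurable_EFinP; apply: subspace_continuous_measurable_fun => //.
by have [] := flow_sum_within B (exhaust_uniq A n) t0.
Qed.

(** Measurability in time is obtained from the finite truncations, which are continuous in time. *)
Lemma P_init_stay_measurable (A B : set S) (t : R) :
  ~` D `<=` A -> B `<=` A -> (0 <= t)%R ->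
  measurable_fun `[0%R, t]
    (fun s : R => P_init P D mu (stay X A s `&` X s @^-1` B)).
Proof.
move=> DA BA t0; apply: (emeasurable_fun_cvg (fun n s =>
    (\sum_(j <- exhaust A n | j \in B) flow X P mu (exhaust A n) s j)%:E)).
  by move=> n; exact: flow_sum_measurable.
by move=> s; rewrite /= in_itv/= => /andP[s0 _]; exact: flow_sum_cvg.
Qed.

Lemma occ_sum_cvg (A B : set S) (t : R) : ~` D `<=` A -> B `<=` A -> (0 <= t)%R ->
  (\sum_(j <- exhaust A n | j \in B) occ X P mu (exhaust A n) t j)%:E
    @[n --> \oo] -->
  \int[lebesgue_measure]_(s in `[0%R, t])
    P_init P D mu (stay X A s `&` X s @^-1` B).
Proof.
move=> DA BA t0; under eq_fun do rewrite occ_sum ?exhaust_uniq//.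
pose g n (s : R) := (\sum_(j <- exhaust A n | j \in B)
  flow X P mu (exhaust A n) s j)%:E.
have -> : \int[lebesgue_measure]_(s in `[0%R, t])
    P_init P D mu (stay X A s `&` X s @^-1` B) =
    \int[lebesgue_measure]_(s in `[0%R, t]) limn (g ^~ s).
  apply: eq_integral => s; rewrite inE/= in_itv/= => /andP[s0 _].
  by apply/esym/cvg_lim => //; exact: flow_sum_cvg.
apply: cvg_monotone_convergence => //.
- by move=> n; exact: flow_sum_measurable.
- by move=> n s _; rewrite lee_fin sumr_ge0// => j _; exact: flow_ge0.
- move=> s; rewrite /= in_itv/= => /andP[s0 _] n m nm; rewrite lee_fin.
  exact: flow_sum_nd.
Qed.

End limits.

(** * Jump rates and mass balance *)

Lemma esum_setI_seq (R : realType) (T : choiceType) (B : set T) (G : seq T)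
    (a : T -> \bar R) : uniq G -> (forall i, B i -> 0 <= a i) ->
  \esum_(i in B `&` [set` G]) a i = \sum_(i <- G | i \in B) a i.
Proof.
move=> uG a0; have -> : B `&` [set` G] = [set` [seq i <- G | i \in B]].
  apply/seteqP; split=> i /=; rewrite mem_filter.
    by move=> [Bi ->]; rewrite andbT; exact/mem_set.
  by move=> /andP[/set_mem].
rewrite esum_fset; last 2 first.
- by apply/finite_seqP; eexists.
- by move=> i /set_mem/=; rewrite mem_filter => /andP[/set_mem Bi _]; exact: a0.
by rewrite -fsbig_seq ?filter_uniq// big_filter.
Qed.

Section ssum.
Context (R : realType) (T : choiceType).

Lemma ssum_ge0 (A : set T) (f : T -> \bar R) : (forall x, A x -> 0 <= f x) ->
  ssum A f = \esum_(x in A) f x.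
Proof.
move=> f0; rewrite /ssum [X in _ - X]esum1 ?sube0; last first.
  by move=> x Ax; rewrite funenegE max_r// leeNl oppe0 f0.
by apply: eq_esum => x Ax; rewrite funeposE max_l// f0.
Qed.

(** The negative part consists of the single term at [x], so the signed sum becomes a nonnegative
    one plus that term. Rows of [q] and columns weighted by [mubar] both have this shape. *)
Lemma ssum_le0_at (A : set T) (f : T -> \bar R) x : A x -> f x <= 0 ->
  (forall y, A y -> y <> x -> 0 <= f y) ->
  ssum A f = \esum_(y in A `\ x) f y + f x.
Proof.
move=> Ax fx f0; have AxE : A `&` [set x] = [set x].
  by apply/seteqP; split=> [y []//|y /= ->].
rewrite /ssum (esumID [set x])// AxE [X in X + _ - _]esum_set1//.
rewrite (esumID [set x] A f^\-)// AxE [X in _ - (X + _)]esum_set1//.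
rewrite [X in _ - (_ + X)]esum1 ?adde0; last first.
  by move=> y [Ay yx]; rewrite funenegE max_r// leeNl oppe0 f0.
rewrite (_ : f^\+ x = 0) ?add0e; last by rewrite funeposE max_r.
rewrite (_ : f^\- x = - f x); last first.
  by rewrite funenegE max_l// leeNr oppe0.
rewrite oppeK; congr (_ + _); apply: eq_esum => y [Ay yx].
by rewrite funeposE max_l// f0.
Qed.

End ssum.

Section rates.
Context (R : realType) (S : countType) (q : S -> S -> R).
Context (q_conservative : conservative q)
  (q_offdiag_ge0 : forall i j, i != j -> (0 <= q i j)%R)
  (q_diag_le0 : forall i, (q i i <= 0)%R).

(* Only meaningful when [i] is not in [A]: the terms are then nonnegative. *)
Definition rate (i : S) (A : set S) : R := fine (\esum_(j in A) (q i j)%:E).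

Let q_ge0 i (A : set S) j : ~ A i -> A j -> 0 <= (q i j)%:E.
Proof.
move=> Ai Aj; rewrite lee_fin q_offdiag_ge0//.
by apply/eqP => ij; apply: Ai; rewrite ij.
Qed.

Lemma ssum_offdiag i (A : set S) : ~ A i ->
  ssum A (fun j => (q i j)%:E) = \esum_(j in A) (q i j)%:E.
Proof. by move=> Ai; apply: ssum_ge0 => j Aj; exact: q_ge0 Ai Aj. Qed.

Lemma ssum_diag i (A : set S) : A i ->
  ssum A (fun j => (q i j)%:E) =
  \esum_(j in A `\ i) (q i j)%:E + (q i i)%:E.
Proof.
move=> Ai; apply: ssum_le0_at => [//||j Aj ji]; first by rewrite lee_fin.
rewrite lee_fin q_offdiag_ge0//.
by apply/eqP => ij; apply: ji; rewrite ij.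
Qed.

(** Conservativity also gives finiteness: an infinite off-diagonal sum plus the real [q i i] could
    not be 0. *)
Lemma esum_offdiag i : \esum_(j in ~` [set i]) (q i j)%:E = (- q i i)%:E.
Proof.
have := q_conservative i; rewrite ssum_diag// setTD.
set x := \esum_(_ in _) _; case: x => [r| |] //=.
by rewrite -EFinD => -[/eqP]; rewrite addr_eq0 => /eqP ->.
Qed.

Lemma rateE i (A : set S) : ~ A i -> \esum_(j in A) (q i j)%:E = (rate i A)%:E.
Proof.
move=> Ai; rewrite /rate fineK// ge0_fin_numE; last first.
  by apply: esum_ge0 => j Aj; exact: q_ge0 Ai Aj.
apply: (@le_lt_trans _ _ (\esum_(j in ~` [set i]) (q i j)%:E)); last first.
  by rewrite esum_offdiag ltry.
rewrite (esumID A (~` [set i])); last first.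
  by move=> j ji; apply: q_ge0 ji; apply.
have -> : ~` [set i] `&` A = A.
  by apply/seteqP; split=> [j []//|j Aj]; split=> // ji; apply: Ai; rewrite -ji.
by apply: leeDl; apply: esum_ge0 => j [ji _]; apply: q_ge0 ji; apply.
Qed.

Lemma rate_ge0 i (A : set S) : ~ A i -> (0 <= rate i A)%R.
Proof.
move=> Ai; rewrite -lee_fin -rateE//; apply: esum_ge0 => j Aj.
exact: q_ge0 Ai Aj.
Qed.

Lemma rate_sub i (A B : set S) : A `<=` B -> ~ B i -> (rate i A <= rate i B)%R.
Proof.
move=> AB Bi; have Ai : ~ A i by move=> /AB.
rewrite -lee_fin -!rateE// (esumID A B); last by move=> j Bj; exact: q_ge0 Bi Bj.
have -> : B `&` A = A by apply/setIidPr.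
by apply: leeDl; apply: esum_ge0 => j [Bj _]; exact: q_ge0 Bi Bj.
Qed.

Lemma rate_setID i (A B : set S) : ~ A i ->
  (rate i A = rate i (A `&` B) + rate i (A `&` ~` B))%R.
Proof.
move=> Ai; apply: EFin_inj; rewrite EFinD -!rateE; try by move=> [].
  by rewrite (esumID B)// => j Aj; exact: q_ge0 Ai Aj.
by [].
Qed.

Lemma rate_set0 i : rate i set0 = 0%R.
Proof. by rewrite /rate esum_set0. Qed.

Lemma rate_compl1 i : (rate i (~` [set i]) = - q i i)%R.
Proof. by apply: EFin_inj; rewrite -rateE ?esum_offdiag//; apply. Qed.

(** What the truncation to [G] misses is the rate into [B] outside [G]; these defects make up the
    leak. *)
Lemma sum_rate_off i (B : set S) (G : seq S) : uniq G -> ~ B i ->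
  (\sum_(j <- G | j \in B) q i j = rate i B - rate i (B `\` [set` G]))%R.
Proof.
move=> uG Bi; rewrite (rate_setID [set` G])// addrK; apply: EFin_inj.
rewrite -rateE; last by case.
by rewrite esum_setI_seq// ?sumEFin// => j Bj; exact: q_ge0 Bi Bj.
Qed.

(** The row of [i] sums to zero, so its signed sum over [B] is minus the rate out of [B]; the
    truncation defect is then subtracted as before. *)
Lemma sum_rate_diag i (B : set S) (G : seq S) : uniq G -> B i -> i \in G ->
  (\sum_(j <- G | j \in B) q i j = - rate i (~` B) - rate i (B `\` [set` G]))%R.
Proof.
move=> uG Bi iG.
have -> : (\sum_(j <- G | j \in B) q i j =
    q i i + \sum_(j <- G | j \in B `\ i) q i j)%R.
  rewrite -(sum_seq_delta uG (fun=> q i i) iG) big_mkcond/=.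
  rewrite [X in (_ + X)%R]big_mkcond -big_split/=; apply: eq_bigr => j _.
  have [->|ji] := eqVneq j i.
    rewrite mulr1 mem_set// ifF ?addr0//.
    by apply/negP => /set_mem[_]; apply.
  rewrite mulr0 add0r; case: ifPn => [/set_mem Bj|/negP nBj].
    by rewrite ifT//; apply/mem_set; split=> //; exact/eqP.
  by rewrite ifF//; apply/negP => /set_mem[Bj _]; apply/nBj/mem_set.
rewrite sum_rate_off//; last by case=> _; apply.
have -> : B `\ i `\` [set` G] = B `\` [set` G].
  apply/seteqP; split=> j /=; first by move=> [[Bj _] jG].
  by move=> [Bj jG]; split=> //; split=> // ji; apply: jG; rewrite ji.
have := rate_compl1 i; rewrite (rate_setID B); last by apply.
have -> : ~` [set i] `&` B = B `\ i by rewrite setIC.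
have -> : ~` [set i] `&` ~` B = ~` B.
  by apply/seteqP; split=> [j []//|j nBj]; split=> // ji; apply: nBj; rewrite ji.
move=> compl; lra.
Qed.

End rates.

(** * The mass balance and the vanishing leak *)

Section mass_balance.
Context (R : realType) (d : measure_display) (Omega : measurableType d)
  (S : countType) (X : R -> Omega -> S) (P : S -> probability Omega R)
  (q : S -> S -> R) (D : set S) (mu : S -> R).
Context (X_markov : markov_chain X P) (X_qmatrix : is_qmatrix X P q)
  (q_conservative : conservative q)
  (X_non_explosive : non_explosive X P) (mu_distribution : distribution_off D mu).

Let mu0 i : (0 <= mu i)%R.
Proof. by case: mu_distribution. Qed.

Let q_off i j : i != j -> (0 <= q i j)%R.
Proof. exact: (qmatrix_offdiag_ge0 X_markov X_qmatrix). Qed.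

Let q_diag i : (q i i <= 0)%R.
Proof. exact: (qmatrix_diag_le0 X_markov X_qmatrix). Qed.

Local Notation rate := (rate q).
Local Notation flow := (flow X P mu).
Local Notation occ := (occ X P mu).

Lemma flow_notin (G : seq S) (t : R) j : (0 <= t)%R -> j \notin G ->
  flow G t j = 0%R.
Proof.
move=> t0 jG; rewrite /flow big1// => i _; apply/eqP.
rewrite mulf_eq0; apply/orP; right; apply/eqP/EFin_inj.
rewrite (killedE X_markov)// (_ : _ `&` _ = set0) ?measure0//.
apply/seteqP; split=> // w [/= sw Xj]; move/negP: jG; apply.
by have := sw t; rewrite add0r /= Xj; apply; rewrite t0 lexx.
Qed.

Lemma occ_notin (G : seq S) (t : R) j : (0 <= t)%R -> j \notin G ->
  occ G t j = 0%R.
Proof.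
move=> t0 jG; rewrite /occ (eq_Rintegral _ (g := cst 0%R)).
  by rewrite Rintegral_cst// mul0r.
by move=> s; rewrite inE/= in_itv/= => /andP[s0 _]; rewrite flow_notin.
Qed.

Lemma occ_exhaust_nd (A : set S) (t : R) j : (0 <= t)%R ->
  {homo (fun n => occ (exhaust A n) t j) : n m / (n <= m)%N >-> (n <= m)%R}.
Proof.
move=> t0 n m nm; have [jG|jG] := boolP (j \in exhaust A n).
  apply: (occ_sub X_markov X_qmatrix) => //; try exact: exhaust_uniq.
  exact: exhaust_sub.
by rewrite occ_notin//; exact: occ_ge0.
Qed.

(** The third term on the left is the leak. No term is subtracted, so the limit in [n] can be taken
    separately in each of them. *)
Lemma mass_balance_exhaust (A B : set S) (t : R) n : (0 <= t)%R ->
  (\sum_(j <- exhaust A n | j \in B) flow (exhaust A n) t j +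
   \sum_(m <- exhaust A n | m \in B) occ (exhaust A n) t m * rate m (~` B) +
   \sum_(m <- exhaust A n) occ (exhaust A n) t m * rate m (B `\` [set` exhaust A n]) =
   \sum_(j <- exhaust A n | j \in B) mu j +
   \sum_(m <- exhaust A n | m \notin B) occ (exhaust A n) t m * rate m B)%R.
Proof.
move=> t0; rewrite (flow_sum_forward mu X_markov X_qmatrix (exhaust_uniq A n) _ t0).
set G := exhaust A n.
have uG : uniq G by exact: exhaust_uniq.
rewrite [X in (_ + X + _ + _)%R](_ : _ =
    \sum_(m <- G | m \notin B) occ G t m * rate m B -
    \sum_(m <- G | m \in B) occ G t m * rate m (~` B) -
    \sum_(m <- G) occ G t m * rate m (B `\` [set` G]))%R; last first.
  rewrite [X in (X - _ - _)%R]big_mkcond [X in (_ - X - _)%R]big_mkcond/=.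
  rewrite -!sumrB big_seq [RHS]big_seq; apply: eq_bigr => m mG.
  case: ifPn => [/negP mB|]; last rewrite negbK => mB.
    rewrite ifF; last exact/negP.
    rewrite sum_rate_off//; last by move=> Bm; apply: mB; exact/mem_set.
    by rewrite subr0 mulrBr.
  by rewrite mB sum_rate_diag//; [rewrite sub0r mulrBr mulrN|exact/set_mem].
lra.
Qed.

(** When [A] and [B] are both [setT] nothing else enters or leaves, so the balance identifies the
    leak with initial mass minus present mass; by non-explosion both tend to 1. In general the
    occupation times and the rates of escape are bounded by those of this case. *)
Lemma leak_cvg0 (A B : set S) (t : R) : B `<=` A -> (0 <= t)%R ->
  (\sum_(m <- exhaust A n) occ (exhaust A n) t m *
     rate m (B `\` [set` exhaust A n]))%R @[n --> \oo] --> (0 : R)%R.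
Proof.
move=> BA t0.
pose L n := (\sum_(m <- exhaust setT n) occ (exhaust setT n) t m *
     rate m (setT `\` [set` exhaust setT n]))%R.
have L0 : L n @[n --> \oo] --> (0 : R)%R.
  have LE n : L n = (\sum_(j <- exhaust setT n | j \in setT) mu j -
      \sum_(j <- exhaust setT n | j \in setT) flow (exhaust setT n) t j)%R.
    have := mass_balance_exhaust setT setT n t0.
    rewrite [X in (_ + X)%R = _ -> _]/(L n).
    rewrite [X in (_ + X + _)%R]big1 ?addr0; last first.
      by move=> m _; rewrite setCT rate_set0 mulr0.
    rewrite [X in _ = (_ + X)%R]big_pred0 ?addr0; last by move=> m; rewrite in_setT.
    by move=> <-; rewrite addrAC subrr add0r.
  under eq_fun do rewrite LE.
  suff : (\sum_(j <- exhaust setT n | j \in setT) mu j -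
      \sum_(j <- exhaust setT n | j \in setT) flow (exhaust setT n) t j)%R
      @[n --> \oo] --> (1 - 1 : R)%R by rewrite [(1 - 1)%R]subrr.
  apply: cvgB.
    suff : (\sum_(j <- exhaust setT n | j \in setT) mu j)%:E @[n --> \oo] --> 1%:E.
      by move/fine_cvgP => [].
    have [_ muD <-] := mu_distribution.
    rewrite (_ : \esum_(i in _) _ = \esum_(i in setT) (mu i)%:E); last first.
      rewrite esum_mkcond; apply: eq_esum => i _; case: ifPn => // /negP iD.
      by rewrite muD//; apply: contrapT => nDi; apply/iD/mem_set.
    under eq_fun do rewrite -sumEFin big_filter_cond.
    have -> : (fun n => \sum_(i <- enum_upto n | (i \in setT) && (i \in setT)) (mu i)%:E)
        = (fun n => \sum_(i <- enum_upto n | i \in setT) (mu i)%:E).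
      by apply/funext => n; apply: eq_bigl => i; rewrite andbb.
    by apply: esum_enum => i _; rewrite lee_fin mu0.
  suff : (\sum_(j <- exhaust setT n | j \in setT) flow (exhaust setT n) t j)%:E
      @[n --> \oo] --> 1%:E by move/fine_cvgP => [].
  have := flow_sum_cvg X_markov X_non_explosive mu_distribution
    (A := setT) (B := setT) (subsetT _) (subsetT _) t0.
  rewrite (_ : stay X setT t `&` _ = setT) ?(P_init_setT P mu_distribution)//.
  by apply/seteqP; split.
apply: (squeeze_cvgr _ (cvg_cst 0%R) L0); apply: nearW => n.
have sub : {subset exhaust A n <= exhaust setT n}.
  by move=> x; rewrite !mem_exhaust in_setT => /andP[].
have notin m : m \in exhaust A n -> ~ (B `\` [set` exhaust A n]) m.
  by move=> mG [].
apply/andP; split.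
  rewrite big_seq; apply: sumr_ge0 => m mG.
  by rewrite mulr_ge0 ?(occ_ge0 _ _ mu0)// rate_ge0//; exact: notin.
(* The intermediate sum has the terms of the case [setT] but runs over the smaller list. The guard
   makes every term nonnegative, also at states where [rate] is not meaningful, as enlarging the
   list requires. *)
apply: (@le_trans _ _ (\sum_(m <- exhaust A n) occ (exhaust setT n) t m *
     (if m \in exhaust setT n then rate m (setT `\` [set` exhaust setT n]) else 0))%R).
  rewrite big_seq [leRHS]big_seq; apply: ler_sum => m mG; rewrite (sub m mG).
  apply: ler_pM; rewrite ?(occ_ge0 _ _ mu0)//.
  - by apply: rate_ge0 => //; exact: notin.
  - apply: (occ_sub X_markov X_qmatrix) => //; exact: exhaust_uniq.
  - apply: rate_sub => //; last by case=> _; apply; exact: sub.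
    move=> x [Bx xG]; split=> // xT; apply: xG.
    move: xT; rewrite /= !mem_exhaust => /andP[_ ->]; rewrite andbT.
    exact/mem_set/BA.
apply: le_trans (ler_sum_sub_seq _ _ sub _) _; try exact: exhaust_uniq.
  move=> m; rewrite mulr_ge0 ?(occ_ge0 _ _ mu0)//; case: ifPn => // mG.
  by apply: rate_ge0 => //; case.
by rewrite big_seq [leRHS]big_seq; apply: ler_sum => m ->.
Qed.

(* Expected time spent in [B] before leaving [~` D] or time [t]. *)
Definition occupation (t : R) (B : set S) : \bar R :=
  \int[lebesgue_measure]_(s in `[0%R, t])
    P_init P D mu (stay X (~` D) s `&` X s @^-1` B).

Lemma occupation_ge0 t B : 0 <= occupation t B.
Proof. by apply: integral_ge0 => s _; exact: (P_init_ge0 P mu_distribution). Qed.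

Lemma occ_cvg (t : R) m : (~` D) m -> (0 <= t)%R ->
  (occ (exhaust (~` D) n) t m)%:E @[n --> \oo] --> occupation t [set m].
Proof.
move=> Dm t0.
have sub1 : [set m] `<=` ~` D by move=> _ ->.
have := occ_sum_cvg X_markov X_qmatrix X_non_explosive mu_distribution
  (@subset_refl _ (~` D)) sub1 t0.
apply: cvg_trans; apply: near_eq_cvg; near=> n; congr EFin.
have mG : m \in exhaust (~` D) n.
  by rewrite mem_exhaust mem_set//=; near: n; exact: nbhs_infty_gt.
rewrite -[RHS](sum_seq_delta (exhaust_uniq _ _) _ mG) [LHS]big_mkcond/=.
apply: eq_bigr => j _.
have [->|/eqP jm] := eqVneq j m; first by rewrite mem_set// mulr1.
by rewrite mulr0 ifF//; apply/negP => /set_mem.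
Unshelve. all: by end_near. Qed.

Lemma occupation_rate_cvg (B : set S) (c : S -> R) (t : R) :
  B `<=` ~` D -> (0 <= t)%R -> (forall m, B m -> (0 <= c m)%R) ->
  (\sum_(m <- exhaust (~` D) n | m \in B) occ (exhaust (~` D) n) t m * c m)%:E
    @[n --> \oo] --> \esum_(m in B) (occupation t [set m] * (c m)%:E).
Proof.
move=> BD t0 c0.
under eq_fun do rewrite -sumEFin big_filter_cond.
have -> : (fun n => \sum_(m <- enum_upto n | (m \in ~` D) && (m \in B))
      (occ (exhaust (~` D) n) t m * c m)%:E) =
    (fun n => \sum_(m <- enum_upto n | m \in B)
      (occ (exhaust (~` D) n) t m * c m)%:E).
  apply/funext => n; apply: eq_bigl => j; apply: andb_idl => /set_mem Bj.
  exact/mem_set/BD.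
apply: esum_enum_cvg.
- by move=> n m Bm; rewrite lee_fin mulr_ge0 ?c0// (occ_ge0 _ _ mu0).
- move=> m Bm n k nk; rewrite lee_fin ler_wpM2r ?c0//.
  exact: occ_exhaust_nd.
- move=> m Bm; under eq_fun do rewrite EFinM.
  by apply: cvgeZr => //; apply: occ_cvg => //; exact: BD.
Qed.

(** Both sides are limits of the same finite sums, by [occupation_rate_cvg] with weights 1 and by
    [occ_sum_cvg]. *)
Lemma occupation_esum (B : set S) (t : R) : B `<=` ~` D -> (0 <= t)%R ->
  \esum_(m in B) occupation t [set m] = occupation t B.
Proof.
move=> BD t0.
have c1 := occupation_rate_cvg BD t0 (fun _ _ => ler01).
have c2 := occ_sum_cvg X_markov X_qmatrix X_non_explosive mu_distribution
  (@subset_refl _ (~` D)) BD t0.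
rewrite -(eq_esum (a := fun m => occupation t [set m] * 1%:E)); last first.
  by move=> m _; rewrite mule1.
apply: (cvg_unique _ c1) => //; move: c2; apply: cvg_trans.
apply: near_eq_cvg; near=> n; congr EFin; apply: eq_bigr => m _.
by rewrite mulr1.
Unshelve. all: by end_near. Qed.

(** The identity holds in [0, +oo]: the flows out of and into [B] are not assumed finite. *)
Lemma mass_balance (B : set S) (t : R) : B `<=` ~` D -> (0 <= t)%R ->
  P_init P D mu (stay X (~` D) t `&` X t @^-1` B) +
  \esum_(m in B) (occupation t [set m] * (rate m (~` B))%:E) =
  \esum_(m in B) (mu m)%:E +
  \esum_(m in ~` D `\` B) (occupation t [set m] * (rate m B)%:E).
Proof.
move=> BD t0; pose G n := exhaust (~` D) n.
have c1 := flow_sum_cvg X_markov X_non_explosive mu_distribution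
  (@subset_refl _ (~` D)) BD t0.
have c2 : (\sum_(m <- G n | m \in B) occ (G n) t m * rate m (~` B))%:E
    @[n --> \oo] --> \esum_(m in B) (occupation t [set m] * (rate m (~` B))%:E).
  by apply: occupation_rate_cvg => // m Bm; apply: rate_ge0 => //; apply.
have c3 : (\sum_(m <- G n) occ (G n) t m * rate m (B `\` [set` G n]))%:E
    @[n --> \oo] --> 0%:E.
  by apply: cvg_EFin; [exact: nearW|exact: leak_cvg0].
have c4 : (\sum_(m <- G n | m \in B) mu m)%:E @[n --> \oo] -->
    \esum_(m in B) (mu m)%:E.
  have mu_ge0 m : B m -> 0 <= (mu m)%:E by rewrite lee_fin mu0.
  move: (esum_enum mu_ge0); apply: cvg_trans; apply: near_eq_cvg; near=> n.
  rewrite -sumEFin big_filter_cond; apply: eq_bigl => m; apply/esym/andb_idl.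
  by move=> /set_mem Bm; exact/mem_set/BD.
have c5 : (\sum_(m <- G n | m \notin B) occ (G n) t m * rate m B)%:E
    @[n --> \oo] -->
    \esum_(m in ~` D `\` B) (occupation t [set m] * (rate m B)%:E).
  have := @occupation_rate_cvg (~` D `\` B) (fun m => rate m B) t
    (@subDsetl _ _ _) t0 (fun m Bm => rate_ge0 q_conservative q_off q_diag Bm.2).
  apply: cvg_trans; apply: near_eq_cvg; near=> n; congr EFin.
  rewrite !big_filter_cond; apply: eq_bigl => m.
  by rewrite in_setD andbA andbb.
rewrite -[LHS]adde0.
have pos (F : S -> \bar R) (A : set S) : (forall m, A m -> 0 <= F m) ->
    0 <= \esum_(m in A) F m by move=> F0; apply: esum_ge0.
have occ_rate0 A C : (forall m, A m -> ~ C m) ->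
    0 <= \esum_(m in A) (occupation t [set m] * (rate m C)%:E).
  move=> AC; apply: esum_ge0 => m /AC Cm.
  by rewrite mule_ge0 ?occupation_ge0// lee_fin rate_ge0.
have BcB m : B m -> ~ (~` B) m by move=> Bm; apply.
have P0 := P_init_ge0 P mu_distribution (stay X (~` D) t `&` X t @^-1` B).
have L := cvgeD (ge0_adde_def _ _)
  (cvgeD (ge0_adde_def _ _) c1 c2) c3.
have r := cvgeD (ge0_adde_def _ _) c4 c5.
apply: cvg_unique (L _ _ _ _ _ _) _ => //; rewrite ?inE//.
- by rewrite adde_ge0// occ_rate0.
- by rewrite occ_rate0.
apply: cvg_trans (r _ _ _).
- apply: near_eq_cvg; near=> n.
  by rewrite /= -!EFinD mass_balance_exhaust.
- by rewrite inE; apply: esum_ge0 => m _; rewrite lee_fin mu0.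
- by rewrite inE occ_rate0// => m [].
Unshelve. all: by end_near. Qed.

End mass_balance.

(** * A comparison principle for linear systems *)

Lemma exists_min_seq (R : realType) (I : eqType) (K : seq I) (x : I -> R -> R)
    (T : R) l0 : (0 <= T)%R -> l0 \in K ->
  (forall l, l \in K -> {within `[0%R, T], continuous (x l)}) ->
  exists l s, [/\ l \in K, (0 <= s <= T)%R &
    forall k u, k \in K -> (0 <= u <= T)%R -> (x l s <= x k u)%R].
Proof.
move=> T0; elim: K l0 => [//|l K IH] l0 _ xc.
have [s sT smin] := EVT_min T0 (xc l (mem_head _ _)).
rewrite in_itv/= in sT.
case: K => [|l1 K] in IH xc *.
  exists l, s; split=> // [|k u]; first exact: mem_head.
  by rewrite inE => /eqP-> uT; apply: smin; rewrite in_itv.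
have [k [u [kK uT ku_min]]] := IH l1 (mem_head _ _)
  (fun j jK => xc j (mem_behead (s := l :: l1 :: K) jK)).
have [le|lt] := leP (x l s) (x k u).
  exists l, s; split=> // [|j v]; first exact: mem_head.
  rewrite in_cons => /predU1P[->|jK] vT; first by apply: smin; rewrite in_itv.
  exact: le_trans le (ku_min j v jK vT).
exists k, u; split=> // [|j v]; first by rewrite in_cons kK orbT.
rewrite in_cons => /predU1P[->|jK] vT; last exact: ku_min.
by apply: le_trans (ltW lt) _; apply: smin; rewrite in_itv.
Qed.

(** Only difference quotients from the left are used, because the minimum may sit at the right end
    of the time interval. *)
Lemma is_derive_min_left (R : realType) (f : R -> R) (s df : R) :
  (0 < s)%R -> is_derive s (1%R : R) f df ->
  (forall u, (0 <= u <= s)%R -> (f s <= f u)%R) -> (df <= 0)%R.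
Proof.
move=> s0 [dfs <-] fmin.
have H : (h^-1 * (f (h * 1 + s) - f s))%R @[h --> (0 : R)%R^'] --> 'D_1 f s.
  exact: dfs.
have Hl := cvg_dnbhs_at_left H.
apply: (ler_cvg_to Hl (cvg_cst 0%R)); near=> h.
have h0 : (h < 0)%R by [].
rewrite mulr1 nmulr_rle0 ?invr_lt0// subr_ge0; apply: fmin.
rewrite -lerBlDr sub0r; apply/andP; split; last by rewrite gerDr ltW.
by near: h; apply: nbhs_left_ge; rewrite oppr_lt0.
Unshelve. all: by end_near. Qed.

(* Comparison principle for a linear system with nonnegative off-diagonal
   coefficients: a negative minimum of [expR (- C s) * y l s] would have a
   positive derivative there. *)
Lemma metzler_ge0 (R : realType) (I : eqType) (K : seq I) (A : I -> I -> R)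
    (y dy : I -> R -> R) :
  (forall k l, k != l -> (0 <= A k l)%R) ->
  (forall l, l \in K -> (0 <= y l 0)%R) ->
  (forall l (T : R), l \in K -> (0 < T)%R -> {within `[0%R, T], continuous (y l)}) ->
  (forall l (t : R), l \in K -> (0 < t)%R ->
    is_derive t (1%R : R) (y l) (dy l t)) ->
  (forall l (t : R), l \in K -> (0 < t)%R ->
    (\sum_(k <- K) y k t * A k l <= dy l t)%R) ->
  forall l (t : R), l \in K -> (0 <= t)%R -> (0 <= y l t)%R.
Proof.
move=> A0 y0 yc yd dyA l t lK; rewrite le_eqVlt => /predU1P[<-|t0].
  exact: y0.
(* [C] exceeds every column sum of [A] over [K]; the 1 makes this strict. *)
pose C := (1 + \sum_(k <- K) \sum_(j <- K) `|A j k|)%R.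
have AC k : k \in K -> (\sum_(j <- K) A j k < C)%R.
  move=> kK; rewrite /C; apply: (@le_lt_trans _ _ (\sum_(j <- K) `|A j k|)%R).
    by apply: ler_sum => j _; exact: ler_norm.
  rewrite [X in (_ < 1 + X)%R](big_rem k)//= addrCA.
  rewrite ltrDl ltr_wpDr//; apply: sumr_ge0 => i _.
  by apply: sumr_ge0 => j _.
pose x k s := (expR (- C * s) * y k s)%R.
have ed (s : R) : is_derive s (1%R : R) (fun s => expR (- C * s))%R
    (- C * expR (- C * s))%R.
  apply: is_derive_eq; by rewrite /GRing.scale/= mulr1 mulrC.
have ec T : {within `[0%R, T], continuous (fun s : R => expR (- C * s))%R}.
  apply: continuous_subspaceT => s; apply/differentiable_continuous/derivable1_diffP.
  by have [] := ed s.
have xc k : k \in K -> {within `[0%R, t], continuous (x k)}.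
  by move=> kK s; apply: cvgM; [exact: ec|exact: yc].
have [k [s [kK /andP[s0 st] kmin]]] := exists_min_seq (ltW t0) lK xc.
have [xk0|xk0] := leP 0%R (x k s).
  rewrite -(@pmulr_rge0 _ (expR (- C * t))) ?expR_gt0//.
  by apply: le_trans xk0 (kmin l t lK _); rewrite lexx ltW.
have {}s0 : (0 < s)%R.
  rewrite lt_neqAle s0 andbT; apply/eqP => s0'; move: xk0.
  by rewrite /x -s0' mulr0 expR0 mul1r ltNge y0.
have xd : is_derive s (1%R : R) (x k)
    (expR (- C * s) * (dy k s - C * y k s))%R.
  have dyk := yd k s kK s0; have de := ed s.
  have := is_deriveM (f := fun s => expR (- C * s)%R) (g := y k) (x := s) (v := 1%R).
  move=> dM; apply: is_derive_eq; rewrite /GRing.scale/=; ring.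
have := is_derive_min_left s0 xd.
have -> : (expR (- C * s) * (dy k s - C * y k s) <= 0)%R = false.
  apply/negbTE; rewrite -ltNge pmulr_rgt0 ?expR_gt0// subr_gt0.
  apply: lt_le_trans (dyA k s kK s0).
  rewrite -(ltr_pM2l (expR_gt0 (- C * s))) mulrCA -/(x k s) mulr_sumr.
  (* By minimality, and as off-diagonal coefficients are nonnegative, replacing each [x j s] by
     [x k s] lowers the sum; since [x k s] is negative and the column sum is below [C], the result
     still exceeds [C * x k s]. *)
  apply: (@lt_le_trans _ _ (\sum_(j <- K) x k s * A j k)%R).
    by rewrite -mulr_sumr mulrC ltr_nM2l// AC.
  rewrite big_seq [leRHS]big_seq; apply: ler_sum => j jK; rewrite mulrA -/(x j s).
  have [->//|jk] := eqVneq j k.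
  by rewrite ler_wpM2r ?A0// kmin// st ltW.
move=> absurd; have // : false; apply: absurd => u /andP[u0 us].
by apply: kmin => //; rewrite u0 (le_trans us).
Qed.

(** * The exponential law *)

(** Regularity is bootstrapped from integrability: [f = 1 - b * F] is continuous because the
    primitive [F] is, hence [F] is differentiable, and [expR (b * s) * f s] has derivative zero. *)
Lemma exp_decay (R : realType) (f : R -> R) (b : R) :
  (forall t : R, (0 < t)%R ->
    lebesgue_measure.-integrable `[0%R, t] (EFin \o f)) ->
  (forall t : R, (0 <= t)%R ->
    f t + b * (\int[lebesgue_measure]_(s in `[0%R, t]) f s) = 1)%R ->
  forall t : R, (0 <= t)%R -> f t = expR (- b * t).
Proof.
move=> fint fE t; rewrite le_eqVlt => /predU1P[<-|t0].
  have := fE 0%R (lexx 0%R).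
  by rewrite set_itv1 Rintegral_set1 mulr0 addr0 mulr0 expR0.
pose F (x : R) := (\int[lebesgue_measure]_(s in `[0%R, x]) f s)%R.
have fF x : (0 <= x)%R -> f x = (1 - b * F x)%R.
  by move=> x0; rewrite -(fE x x0) addrK.
have Fc T : (0 < T)%R -> {within `[0%R, T], continuous F}.
  move=> T0; exact: (parameterized_integral_continuous (ltW T0) (fint T T0)).
have Fcx x : (0 < x)%R -> {for x, continuous F}.
  move=> x0; have x1 : (0 < x + 1)%R by rewrite addr_gt0.
  have /(continuous_within_itvP _ x1)[+ _ _] := Fc _ x1.
  by move=> Fin; apply: Fin; rewrite in_itv/= x0 ltrDl ltr01.
have fc x : (0 < x)%R -> {for x, continuous f}.
  move=> x0; have : (1 - b * F s)%R @[s --> x] --> f x.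
    rewrite fF ?ltW//; apply: cvgB; first exact: cvg_cst.
    by apply: cvgM; [exact: cvg_cst|exact: Fcx].
  apply: cvg_trans; apply: near_eq_cvg; near=> s; rewrite fF//.
  by apply/ltW; near: s; exact: lt_nbhsr.
have Fd (x : R) : (0 < x)%R -> is_derive x (1%R : R) F (f x).
  move=> x0; have x1 : (x < x + 1)%R by rewrite ltrDl.
  have [] := continuous_FTC1_closed x1 (fint _ (lt_trans x0 x1)) x0 (fc x x0).
  by move=> dF; rewrite derive1E => Fx; split.
(* For nonnegative [s] this is [expR (b * s) * f s], written with [F], which is known to be
   continuous up to the end point 0. *)
pose g s := (expR (b * s) * (1 - b * F s))%R.
have ed (s : R) : is_derive s (1%R : R) (fun s => expR (b * s))%R
    (b * expR (b * s))%R.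
  by apply: is_derive_eq; rewrite /GRing.scale/= mulr1 mulrC.
have gd (s : R) : (0 < s)%R -> is_derive s (1%R : R) g 0%R.
  move=> s0; have := Fd s s0; have := ed s => de dF.
  apply: is_derive_eq; rewrite /GRing.scale/= fF ?ltW//; ring.
have gc : {within `[0%R, t], continuous g}.
  move=> s; apply: cvgM; last first.
    apply: cvgB; first exact: cvg_cst.
    by apply: cvgM; [exact: cvg_cst|exact: Fc].
  have : {within `[0%R, t], continuous (fun s : R => expR (b * s))%R}.
    apply: continuous_subspaceT => x.
    by apply/differentiable_continuous/derivable1_diffP; have [] := ed x.
  exact.
have [|c _] := MVT t0 _ gc (df := fun=> 0%R).
  by move=> x; rewrite in_itv/= => /andP[x0 _]; exact: gd.
rewrite mul0r => /eqP; rewrite subr_eq0 => /eqP.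
rewrite /g -(fF t (ltW t0)) -(fF 0%R (lexx _)) mulr0 expR0 mul1r.
have -> : f 0%R = 1%R.
  by have := fE 0%R (lexx 0%R); rewrite set_itv1 Rintegral_set1 mulr0 addr0.
by move=> E; rewrite mulNr expRN -[RHS]mulr1 -E mulKf// gt_eqF// expR_gt0.
Unshelve. all: by end_near. Qed.

Lemma exponential_prob_tail (R : realType) (a r : R) : (0 < a)%R -> (0 <= r)%R ->
  exponential_prob a `]r, +oo[ = (expR (- a * r))%:E.
Proof.
move=> a0 r0.
pose nu : probability _ R :=
  exponential_distribution_exponential_prob__canonical__probability_measure_Probability a0.
have nuE V : nu V = exponential_prob a V by [].
have -> : `]r, +oo[%classic = ~` `]-oo, r]%classic by rewrite setCitvl.
rewrite -nuE probability_setC//.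
have -> : nu `]-oo, r]%classic = nu `[0%R, r]%classic.
  have -> : `]-oo, r]%classic = `]-oo, 0%R[%classic `|` `[0%R, r]%classic.
    apply/seteqP; split=> x /=; rewrite !in_itv/=.
      by move=> xr; have [x0|x0] := ltP x 0%R; [left|right; rewrite xr].
    by move=> [x0|/andP[]//]; exact: le_trans (ltW x0) r0.
  rewrite measureU//; last first.
    apply/seteqP; split=> x //=; rewrite !in_itv/= => -[x0 /andP[x0' _]].
    by move: x0; rewrite ltNge x0'.
  rewrite [X in X + _](_ : _ = 0) ?add0e//.
  rewrite -[LHS]/(exponential_prob a `]-oo, 0%R[%classic).
  apply: integral0_eq => x /=; rewrite in_itv/= => x0.
  by rewrite lt0_exponential_pdf.
rewrite nuE; move: r0; rewrite le_eqVlt => /predU1P[<-|r0].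
  by rewrite set_itv1 /exponential_prob integral_set1 sube0 mulr0 expR0.
by rewrite exponential_prob_itv0c// oppeB// addeA subee// add0e.
Qed.

Lemma exponential_prob_tail_neg (R : realType) (a r : R) : (0 < a)%R -> (r < 0)%R ->
  exponential_prob a `]r, +oo[ = 1.
Proof.
move=> a0 r0.
pose nu : probability _ R :=
  exponential_distribution_exponential_prob__canonical__probability_measure_Probability a0.
have nuE V : nu V = exponential_prob a V by [].
rewrite -nuE; apply/eqP; rewrite eq_le probability_le1//=.
have <- : nu setT = 1 by exact: probability_setT.
have -> : [set: R] = `]-oo, r]%classic `|` `]r, +oo[%classic.
  by rewrite -setCitvl setUv.
rewrite measureU//; last by rewrite -setCitvl setICr.
rewrite [X in X + _](_ : _ = 0) ?add0e//.
rewrite -[LHS]/(exponential_prob a `]-oo, r]%classic).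
apply: integral0_eq => x /=; rewrite in_itv/= => xr.
by rewrite lt0_exponential_pdf// (le_lt_trans xr).
Qed.

(** The law of [T] and the exponential law are compared as measures on the extended line, where [T]
    may be infinite. They agree on the rays, a generating family stable under intersection, hence
    everywhere. *)
Lemma exponentially_distributed_tail (R : realType) (d : measure_display)
    (Omega : measurableType d) (m : {measure set Omega -> \bar R})
    (T : Omega -> \bar R) (a : R) : (0 < a)%R -> m setT = 1 ->
  (forall w, 0 <= T w) ->
  (forall t : R, (0 <= t)%R -> measurable [set w | t%:E < T w] /\
    m [set w | t%:E < T w] = (expR (- a * t))%:E) ->
  exponentially_distributed m T a.
Proof.
move=> a0 m1 T0 Ttail; split=> // B mB.
have preT (r : R) : T @^-1` `]r%:E, +oo[%classic = [set w | r%:E < T w].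
  by apply/seteqP; split=> w /=; rewrite in_itv/= andbT.
have Tneg (r : R) : (r < 0)%R -> [set w | r%:E < T w] = setT.
  by move=> r0; apply/seteqP; split=> // w _ /=; rewrite (lt_le_trans _ (T0 w))// lte_fin.
have mT : measurable_fun setT T.
  apply: (measurability _ (ErealGenOInfty.measurableE R)) => _ [_ [r ->] <-].
  rewrite setTI preT; have [r0|r0] := leP 0%R r; first by have [] := Ttail r r0.
  by rewrite Tneg.
have mEFin : measurable_fun [set: R] (@EFin R) by exact: EFin_measurable.
pose nu : probability _ R :=
  exponential_distribution_exponential_prob__canonical__probability_measure_Probability a0.
pose m1' : {measure set (\bar R) -> \bar R} :=
  measure_function_pushforward__canonical__measure_function_Measure m mT.
pose m2' : {measure set (\bar R) -> \bar R} :=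
  measure_function_pushforward__canonical__measure_function_Measure nu mEFin.
(* [setT] is added because the uniqueness theorem asks for a cover by sets of finite measure from
   the family, and no countable union of rays contains [-oo]. *)
pose G := ErealGenOInfty.G (R := R) `|` [set setT].
have GE (A : set (\bar R)) : measurable A -> <<s G >> A.
  rewrite [measurable]ErealGenOInfty.measurableE; apply: sub_smallest2r.
    exact: smallest_sigma_algebra.
  by move=> U GU; left.
have preE : B = @EFin R @^-1` (EFin @` B).
  by apply/seteqP; split=> x /=; [exists x|move=> [y By [<-]]].
rewrite [in RHS]preE.
have := @g_sigma_algebra_measure_unique _ R _ G _ (fun=> setT) _ _ m1' m2' _ _ _
  (EFin @` B) (GE _ (measurable_image_EFin mB)).
apply.
- move=> _ [[r ->]|->]; last exact: measurableT.
  rewrite [measurable]ErealGenOInfty.measurableE; apply: sub_sigma_algebra.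
  by exists r.
- by move=> _; right.
- by apply/seteqP; split=> // x _; exists 0%N.
- move=> _ _ [[r ->]|->] [[s ->]|->]; rewrite ?setIT ?setTI; [|by left; exists r|by left; exists s|by right].
  left; exists (Num.max r s); apply/seteqP; split=> x /=; rewrite !in_itv/= !andbT.
    by move=> [rx sx]; rewrite EFin_max gt_max rx.
  by rewrite EFin_max gt_max => /andP[].
- move=> _ [[r ->]|->]; rewrite /m1' /m2' /= /pushforward; last first.
    rewrite !preimage_setT m1; apply/esym.
    by have := @probability_setT _ _ _
      (exponential_distribution_exponential_prob__canonical__probability_measure_Probability a0).
  rewrite preT.
  have -> : @EFin R @^-1` `]r%:E, +oo[%classic = `]r, +oo[%classic.
    by apply/seteqP; split=> x /=; rewrite !in_itv/= !andbT ?lte_fin.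
  have [r0|r0] := leP 0%R r.
    by have [_ ->] := Ttail r r0; rewrite exponential_prob_tail.
  by rewrite Tneg// m1 exponential_prob_tail_neg.
- by move=> _; rewrite /m1' /= /pushforward preimage_setT m1 ltry.
Qed.

(** * Lumping *)

Lemma esumZr (R : realType) (T : countType) (A : set T) (a : T -> \bar R) (c : R) :
  (forall x, A x -> 0 <= a x) -> (0 <= c)%R ->
  \esum_(x in A) (a x * c%:E) = (\esum_(x in A) a x) * c%:E.
Proof.
move=> a0 c0; have ac0 x : A x -> 0 <= a x * c%:E.
  by move=> Ax; rewrite mule_ge0 ?a0// lee_fin.
apply: (cvg_unique _ (esum_enum ac0)) => //.
have : (\sum_(x <- enum_upto n | x \in A) a x) * c%:E @[n --> \oo] -->
    (\esum_(x in A) a x) * c%:E by apply: cvgeZr => //; exact: esum_enum.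
apply: cvg_trans.
apply: near_eq_cvg; near=> n; rewrite muleC ge0_sume_distrr; last first.
  by move=> x /set_mem /a0.
by apply: eq_bigr => x _; rewrite muleC.
Unshelve. all: by end_near. Qed.

Lemma hitting_time_ge0 (R : realType) (Omega : Type) (S : countType)
    (X : R -> Omega -> S) (D : set S) w : 0 <= hitting_time X D w.
Proof. by apply: le_ereal_inf_tmp => _ [s [s0 _] <-]; rewrite lee_fin. Qed.

Section blocks.
Context (R : realType) (d : measure_display) (Omega : measurableType d)
  (S : countType) (X : R -> Omega -> S) (P : S -> probability Omega R)
  (q : S -> S -> R) (D : set S) (I : countType) (k1 : I) (E : I -> set S)
  (mu : S -> R).
Context (X_markov : markov_chain X P) (X_qmatrix : is_qmatrix X P q)
  (q_conservative : conservative q) (X_non_explosive : non_explosive X P)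
  (E_partition : partition [set: I] E [set: S]) (E_k1 : E k1 = D)
  (q_lumpable : lumpable_off q E k1) (mu_distribution : distribution_off D mu).

(** The inequality is strict because a path outside [D] at time [t] remains outside for a positive
    time, by right-continuity. *)
Lemma hitting_time_gt (t : R) : (0 <= t)%R ->
  [set w | t%:E < hitting_time X D w] = stay X (~` D) t.
Proof.
move=> t0; apply/seteqP; split=> w /=.
  move=> tT u /andP[u0 ut]; rewrite add0r => Du.
  have : hitting_time X D w <= u%:E by apply: ereal_inf_lbound; exists u.
  by rewrite leNgt (le_lt_trans _ tT)// lee_fin.
move=> sw; have /nbhs_right0P := mc_right_continuous X_markov w t0.
move=> [e /= e0 Xe]; apply: (@lt_le_trans _ _ (t + e)%:E).
  by rewrite lte_fin ltrDl.
apply: le_ereal_inf_tmp => _ [s [s0 Ds] <-]; rewrite lee_fin leNgt.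
apply/negP => ste; have [st|ts] := leP s t.
  by have := sw s; rewrite add0r s0 st => /(_ isT); apply.
have := Xe (s - t)%R; rewrite /= sub0r normrN gtr0_norm ?subr_gt0//.
rewrite ltrBlDl ste addrC subrK => /(_ isT ts) Xst.
by have := sw t; rewrite add0r t0 lexx -Xst => /(_ isT); apply.
Qed.

Let mu0 i : (0 <= mu i)%R.
Proof. by case: mu_distribution. Qed.

Let q_off i j : i != j -> (0 <= q i j)%R.
Proof. exact: (qmatrix_offdiag_ge0 X_markov X_qmatrix). Qed.

Let q_diag i : (q i i <= 0)%R.
Proof. exact: (qmatrix_diag_le0 X_markov X_qmatrix). Qed.

Local Notation Qbar := (lumped_qmatrix q E k1).
Local Notation mubar := (block_mass E mu).
Local Notation rate := (rate q).
Local Notation occupation := (occupation X P D mu).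

Lemma block_disjoint k l i : E k i -> E l i -> k = l.
Proof.
have [_ tE _] := E_partition => Eki Eli; apply: tE => //.
by exists i.
Qed.

Lemma block_exists i : exists k, E k i.
Proof.
have [cE _ _] := E_partition; have : [set: S] i by [].
by rewrite -cE => -[k _ Eki]; exists k.
Qed.

Lemma block_nonempty k : exists i, E k i.
Proof. by have [_ _ Ene] := E_partition; exact: Ene. Qed.

Lemma bigcup_blocks (K : set I) :
  ~` (\bigcup_(k in ~` K) E k) = \bigcup_(k in K) E k.
Proof.
apply/seteqP; split=> i.
  move=> nEi; have [k Eki] := block_exists i; exists k => //.
  by apply: contrapT => nKk; apply: nEi; exists k.
move=> [k Kk Eki] [l nKl Eli]; apply: nKl.
by rewrite (block_disjoint Eli Eki).
Qed.

Lemma setC_block l : ~` E l = \bigcup_(k in [set k | k != l]) E k.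
Proof.
rewrite -bigcup_blocks; congr (~` _); apply/seteqP; split=> i.
  by move=> Eli; exists l => //=; apply/negP; rewrite eqxx.
by move=> [k /= /negP]; rewrite negbK => /eqP ->.
Qed.

Lemma setC_D : ~` D = \bigcup_(k in [set k | k != k1]) E k.
Proof. by rewrite -setC_block E_k1. Qed.

Lemma setDD_block l :
  ~` D `\` E l = \bigcup_(k in [set k | k != k1 /\ k != l]) E k.
Proof.
rewrite setC_D; apply/seteqP; split=> i.
  move=> [[k /= kk1 Eki] nEl]; exists k => //; split=> //.
  by apply/eqP => kl; apply: nEl; rewrite -kl.
move=> [k [kk1 kl] Eki]; split; first by exists k.
by move=> Eli; move: kl; rewrite (block_disjoint Eki Eli) eqxx.
Qed.

Lemma block_subD k : k != k1 -> E k `<=` ~` D.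
Proof. by move=> kk1 i Eki; rewrite setC_D; exists k. Qed.

Lemma block_trivIset (K : set I) : trivIset K E.
Proof. by have [_ tE _] := E_partition => k l _ _; exact: tE. Qed.

Lemma block_notin k l i : k != l -> E k i -> ~ E l i.
Proof. by move=> kl Eki Eli; move: kl; rewrite (block_disjoint Eki Eli) eqxx. Qed.

Lemma common_rateE k l i : k != k1 -> E k i ->
  common_rate q E k l = block_rate q E i l.
Proof.
move=> kk1 Eki; apply: xget_unique => [i' Eki'|r rE].
  exact: (@q_lumpable k l kk1 _ _ Eki' Eki).
by rewrite rE.
Qed.

Lemma lumped_qmatrix_k1 l : Qbar k1 l = 0.
Proof. by rewrite /lumped_qmatrix eqxx. Qed.

Lemma lumped_qmatrix_off k l i : k != k1 -> k != l -> E k i ->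
  Qbar k l = (rate i (E l))%:E.
Proof.
move=> kk1 kl Eki; rewrite /lumped_qmatrix (negbTE kk1) (negbTE kl).
rewrite (common_rateE _ kk1 Eki) /block_rate.
have nEl := block_notin kl Eki.
by rewrite (ssum_offdiag q_off)// (rateE q_conservative q_off q_diag).
Qed.

(** The other blocks partition the complement of [E k], so the rates into them add up to the rate of
    leaving [E k]. *)
Lemma lumped_qmatrix_diag k i : k != k1 -> E k i ->
  Qbar k k = - (rate i (~` E k))%:E.
Proof.
move=> kk1 Eki; rewrite /lumped_qmatrix (negbTE kk1) eqxx; congr (- _).
have rE l : l != k -> common_rate q E k l = \esum_(j in E l) (q i j)%:E.
  move=> lk; rewrite (common_rateE _ kk1 Eki) /block_rate (ssum_offdiag q_off)//.
  by apply: (@block_notin k) => //; rewrite eq_sym.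
have q0 l j : l != k -> E l j -> 0 <= (q i j)%:E.
  move=> lk Elj; rewrite lee_fin q_off//; apply/eqP => ij.
  by move: lk; rewrite (block_disjoint Elj (k := l) (l := k)) ?eqxx// -ij.
rewrite ssum_ge0; last by move=> l /= lk; rewrite rE//; apply: esum_ge0 => j; exact: q0.
under eq_esum => l lk do rewrite rE//.
rewrite -(rateE q_conservative q_off q_diag); last by apply.
rewrite setC_block.
by rewrite esum_trivIset//; exact: block_trivIset.
Qed.

Lemma esum_blocks (K : set I) (a : S -> \bar R) :
  (forall k i, K k -> E k i -> 0 <= a i) ->
  \esum_(i in \bigcup_(k in K) E k) a i = \esum_(k in K) \esum_(i in E k) a i.
Proof. by move=> a0; rewrite esum_trivIset//; exact: block_trivIset. Qed.

(** Lumpability makes the rate into [E l] constant on each [E k], so it factors out, and the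
    occupation times of the states add up to that of the block. *)
Lemma occupation_lumped (K : set I) l (t : R) :
  (forall k, K k -> k != k1 /\ k != l) -> (0 <= t)%R ->
  \esum_(i in \bigcup_(k in K) E k) (occupation t [set i] * (rate i (E l))%:E) =
  \esum_(k in K) (occupation t (E k) * Qbar k l).
Proof.
move=> Kl t0.
have r0 k i : K k -> E k i -> (0 <= rate i (E l))%R.
  by move=> /Kl[_ kl] Eki; apply: rate_ge0 => //; exact: block_notin kl Eki.
have V0 := occupation_ge0 X P mu_distribution t.
rewrite esum_blocks; last first.
  by move=> k i Kk Eki; rewrite mule_ge0// lee_fin (r0 k).
apply: eq_esum => k Kk; have [kk1 kl] := Kl k Kk.
have [i0 Eki0] := block_nonempty k.
have QE i : E k i -> Qbar k l = (rate i (E l))%:E by exact: lumped_qmatrix_off.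
rewrite -(occupation_esum X_markov X_qmatrix X_non_explosive mu_distribution
  (block_subD kk1) t0).
rewrite (QE _ Eki0) -esumZr//; last exact: (r0 k).
by apply: eq_esum => i Eki; rewrite -QE// (QE _ Eki0).
Qed.

Lemma mass_balance_D (t : R) : (0 <= t)%R ->
  P_init P D mu (stay X (~` D) t) +
  \esum_(k in [set k | k != k1]) (occupation t (E k) * Qbar k k1) = 1.
Proof.
move=> t0; have [_ _ mu1] := mu_distribution.
have := mass_balance X_markov X_qmatrix q_conservative X_non_explosive
  mu_distribution (@subset_refl _ (~` D)) t0.
rewrite setDv esum_set0 adde0 mu1 setCK => <-; congr (_ + _).
  congr (P_init _ _ _ _); apply/seteqP; split=> w /=; last by case.
  by move=> sw; split=> //; have := sw t; rewrite add0r t0 lexx; exact.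
by rewrite -occupation_lumped// -setC_D E_k1.
Qed.

Lemma mass_balance_block l (t : R) : l != k1 -> (0 <= t)%R ->
  P_init P D mu (stay X (~` D) t `&` X t @^-1` E l) +
  occupation t (E l) * (- Qbar l l) =
  mubar l +
  \esum_(k in [set k | k != k1 /\ k != l]) (occupation t (E k) * Qbar k l).
Proof.
move=> lk1 t0; have [i0 Eli0] := block_nonempty l.
have := mass_balance X_markov X_qmatrix q_conservative X_non_explosive
  mu_distribution (block_subD lk1) t0.
rewrite setDD_block occupation_lumped// => <-; congr (_ + _).
have QE i : E l i -> - Qbar l l = (rate i (~` E l))%:E.
  by move=> Eli; rewrite (lumped_qmatrix_diag lk1 Eli) oppeK.
rewrite -(occupation_esum X_markov X_qmatrix X_non_explosive mu_distribution
  (block_subD lk1) t0) (QE _ Eli0) -esumZr; last 2 first.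
- by move=> i _; exact: occupation_ge0.
- by apply: rate_ge0 => //; apply.
by apply: eq_esum => i Eli; rewrite -(QE i0)// (QE i).
Qed.

End blocks.

Lemma integral_expR (R : realType) (a t : R) : (0 < a)%R -> (0 <= t)%R ->
  \int[lebesgue_measure]_(s in `[0%R, t]) (expR (- a * s))%:E =
  ((1 - expR (- a * t)) / a)%:E.
Proof.
move=> a0; rewrite le_eqVlt => /predU1P[<-|t0].
  by rewrite set_itv1 integral_set1 mulr0 expR0 subrr mul0r.
have mexp : measurable_fun `[0%R, t] (fun s : R => (expR (- a * s))%:E).
  apply/measurable_EFinP; apply: measurable_funTS.
  by apply: measurableT_comp => //; exact: measurable_funM.
have : (a%:E * \int[lebesgue_measure]_(s in `[0%R, t]) (expR (- a * s))%:E =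
    (1 - expR (- a * t))%:E).
  rewrite -ge0_integralZl_EFin//; last exact: ltW.
  rewrite EFinB -exponential_prob_itv0c//; apply: eq_integral => s.
  rewrite inE/= in_itv/= => /andP[s0 _].
  by rewrite exponential_pdfE// EFinM.
set J := \int[_]_(_ in _) _ => aJ.
rewrite mulrC EFinM -aJ muleA -EFinM mulVf ?mul1e// gt_eqF//.
Qed.

(** * Quasi-stationarity and the lumped equation *)

Section quasi_stationarity.
Context (R : realType) (d : measure_display) (Omega : measurableType d)
  (S : countType) (X : R -> Omega -> S) (P : S -> probability Omega R)
  (q : S -> S -> R) (D : set S) (I : countType) (k1 : I) (E : I -> set S)
  (mu : S -> R).
Context (X_markov : markov_chain X P) (X_irreducible : irreducible_chain X P)
  (X_qmatrix : is_qmatrix X P q)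
  (q_conservative : conservative q) (X_non_explosive : non_explosive X P)
  (E_partition : partition [set: I] E [set: S]) (E_k1 : E k1 = D)
  (q_lumpable : lumpable_off q E k1) (mu_distribution : distribution_off D mu).

Let mu0 i : (0 <= mu i)%R.
Proof. by case: mu_distribution. Qed.

Let q_off i j : i != j -> (0 <= q i j)%R.
Proof. exact: (qmatrix_offdiag_ge0 X_markov X_qmatrix). Qed.

Let q_diag i : (q i i <= 0)%R.
Proof. exact: (qmatrix_diag_le0 X_markov X_qmatrix). Qed.

Local Notation Qbar := (lumped_qmatrix q E k1).
Local Notation mubar := (block_mass E mu).
Local Notation rate := (rate q).
Local Notation occupation := (occupation X P D mu).
Local Notation survival t := (P_init P D mu (stay X (~` D) t)).
Local Notation survival_in k t :=
  (P_init P D mu (stay X (~` D) t `&` X t @^-1` E k)).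

Let Pmu_ge0 A : 0 <= P_init P D mu A.
Proof. exact: (P_init_ge0 P mu_distribution). Qed.

Let P_init_le A B : measurable A -> measurable B -> A `<=` B ->
  P_init P D mu A <= P_init P D mu B.
Proof.
move=> mA mB AB; have [m <-] := P_init_measure P mu_distribution.
by apply: le_measure; rewrite ?inE.
Qed.

Let mXin t A : (0 <= t)%R -> measurable (X t @^-1` A).
Proof.
move=> t0; apply: (past_measurable X_markov (s := t)).
by apply: past_preimage; rewrite t0 lexx.
Qed.

Let mstay t : (0 <= t)%R -> measurable (stay X (~` D) t).
Proof. exact: (measurable_stay X_markov). Qed.

Lemma survivalE t : (0 <= t)%R ->
  survival t = P_init P D mu (stay X (~` D) t `&` X t @^-1` (~` D)).
Proof.
move=> t0; congr (P_init _ _ _ _); apply/seteqP; split=> w /=; last by case.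
by move=> sw; split=> //; have := sw t; rewrite add0r t0 lexx; exact.
Qed.

Lemma survival_fin t : (0 <= t)%R -> survival t \is a fin_num.
Proof. by move=> t0; apply: (P_init_fin_num P mu_distribution); exact: mstay. Qed.

Lemma survival_in_fin k t : (0 <= t)%R -> survival_in k t \is a fin_num.
Proof.
move=> t0; apply: (P_init_fin_num P mu_distribution).
by apply: measurableI; [exact: mstay|exact: mXin].
Qed.

Lemma survival_in_k1 t : (0 <= t)%R -> survival_in k1 t = 0.
Proof.
move=> t0; rewrite E_k1 (_ : _ `&` _ = set0).
  by have [m <-] := P_init_measure P mu_distribution; rewrite measure0.
apply/seteqP; split=> // w [/= sw XD].
by have := sw t; rewrite add0r t0 lexx => /(_ isT); apply.
Qed.

Lemma survival_sum t : (0 <= t)%R ->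
  survival t = \esum_(k in [set k | k != k1]) survival_in k t.
Proof.
move=> t0; have mX1 j : measurable (X t @^-1` [set j]) by exact: mXin.
have split_init B := P_init_esum P mu_distribution B (mstay t0) mX1.
rewrite survivalE// split_init.
transitivity (\esum_(j in \bigcup_(k in [set k | k != k1]) E k)
    P_init P D mu (stay X (~` D) t `&` X t @^-1` [set j])).
  by rewrite -(setC_D E_partition E_k1).
rewrite (esum_blocks E_partition)//; apply: eq_esum => k _.
by rewrite split_init.
Qed.

Lemma mubar_ge0 k : 0 <= mubar k.
Proof. by apply: esum_ge0 => i _; rewrite lee_fin. Qed.

Lemma mubar_k1 : mubar k1 = 0.
Proof.
have [_ muD _] := mu_distribution.
by apply: esum1 => i; rewrite E_k1 => Di; rewrite muD.
Qed.

Lemma mubar_sum : \esum_(k in [set k | k != k1]) mubar k = 1.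
Proof.
have [_ _ <-] := mu_distribution; rewrite (setC_D E_partition E_k1).
by rewrite (esum_blocks E_partition)// => k i _ _; rewrite lee_fin.
Qed.

Lemma mubar_fin k : mubar k \is a fin_num.
Proof.
have [->|kk1] := eqVneq k k1; first by rewrite mubar_k1.
rewrite ge0_fin_numE ?mubar_ge0//; apply: (@le_lt_trans _ _ 1); last exact: ltry.
have := sum_seq_le_esum [set k | k != k1] mubar (r := [:: k]) isT.
by rewrite mubar_sum big_cons big_nil mem_set// adde0.
Qed.

Let qbar_ge0 k l : k != l -> 0 <= Qbar k l.
Proof.
move=> kl; have [->|kk1] := eqVneq k k1; first by rewrite lumped_qmatrix_k1.
have [i Eki] := block_nonempty E_partition k.
rewrite (lumped_qmatrix_off X_markov X_qmatrix q_conservative E_partition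
  q_lumpable kk1 kl Eki) lee_fin.
by apply: rate_ge0 => //; exact: (block_notin E_partition kl).
Qed.

Let qbar_fin k l : Qbar k l \is a fin_num.
Proof.
have [->|kk1] := eqVneq k k1; first by rewrite lumped_qmatrix_k1.
have [i Eki] := block_nonempty E_partition k.
have [<-|kl] := eqVneq k l.
  by rewrite (lumped_qmatrix_diag X_markov X_qmatrix q_conservative E_partition
    q_lumpable kk1 Eki).
by rewrite (lumped_qmatrix_off X_markov X_qmatrix q_conservative E_partition
  q_lumpable kk1 kl Eki).
Qed.

Let qbar_diag_le0 l : Qbar l l <= 0.
Proof.
have [->|lk1] := eqVneq l k1; first by rewrite lumped_qmatrix_k1.
have [i Eli] := block_nonempty E_partition l.
rewrite (lumped_qmatrix_diag X_markov X_qmatrix q_conservative E_partition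
    q_lumpable lk1 Eli).
by rewrite leeNl oppe0 lee_fin rate_ge0//; apply.
Qed.

Lemma column_k1 : ssum [set: I] (fun k => mubar k * Qbar k k1) =
  \esum_(k in [set k | k != k1]) (mubar k * Qbar k k1).
Proof.
rewrite ssum_ge0 => [|k _]; last first.
  have [->|kk1] := eqVneq k k1; first by rewrite mubar_k1 mul0e.
  by rewrite mule_ge0 ?mubar_ge0 ?qbar_ge0.
rewrite [RHS]esum_mkcond; apply: eq_esum => k _; case: ifPn => // /negP kk1.
have -> : k = k1 by apply: contrapT => /eqP kk1'; apply: kk1; exact/mem_set.
by rewrite mubar_k1 mul0e.
Qed.

Lemma column_block l : l != k1 ->
  ssum [set: I] (fun k => mubar k * Qbar k l) =
  \esum_(k in [set k | k != k1 /\ k != l]) (mubar k * Qbar k l) +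
  mubar l * Qbar l l.
Proof.
move=> lk1; rewrite (ssum_le0_at (x := l))//; last 2 first.
- by rewrite mule_ge0_le0 ?mubar_ge0.
- by move=> k _ /eqP kl; rewrite mule_ge0 ?mubar_ge0 ?qbar_ge0.
congr (_ + _); rewrite esum_mkcond [RHS]esum_mkcond; apply: eq_esum => k _.
have [->|kk1] := eqVneq k k1; first by rewrite mubar_k1 mul0e; do 2 case: ifP.
have [->|kl] := eqVneq k l.
  rewrite !ifF//; apply/negP => /set_mem[]; last by move=> _; apply.
  by rewrite eqxx.
by rewrite !ifT//; apply/mem_set; split=> //; exact/eqP.
Qed.

Lemma survival_exponential (a : R) : (0 < a)%R ->
  (forall t, (0 <= t)%R -> survival t = (expR (- a * t))%:E) ->
  exponentially_distributed (P_init P D mu) (hitting_time X D) a.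
Proof.
move=> a0 sE; have [m mE] := P_init_measure P mu_distribution; rewrite -mE.
apply: exponentially_distributed_tail => //.
- by rewrite mE (P_init_setT P mu_distribution).
- by move=> w; exact: hitting_time_ge0.
- by move=> t t0; rewrite (hitting_time_gt D X_markov)// mE sE//; split=> //; exact: mstay.
Qed.

(** This excludes the rate 0. [D] contains a state because it is a block, and irreducibility lets a
    state charged by [mu] reach it with positive probability. *)
Lemma survival_lt1 : exists2 t : R, (0 < t)%R & survival t < 1.
Proof.
have [_ muD mu1] := mu_distribution.
have [i mui] : exists i, (0 < mu i)%R.
  apply: contrapT => nmu; have : \esum_(i in ~` D) (mu i)%:E = 0.
    apply: esum1 => i _; apply/eqP; rewrite eqe eq_le mu0 andbT leNgt.
    by apply/negP => mui; apply: nmu; exists i.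
  by rewrite mu1 => /eqP; rewrite onee_eq0.
have [j] := block_nonempty E_partition k1; rewrite E_k1 => Dj.
have [t t0 pij] := X_irreducible i j; exists t => //.
have t0' := ltW t0.
have Di : (~` D) i by move=> /muD mui0; move: mui; rewrite mui0 ltxx.
have mj : measurable (X t @^-1` [set j]) by exact: mXin.
have pos : 0 < P_init P D mu (X t @^-1` [set j]).
  apply: (@lt_le_trans _ _ ((mu i)%:E * P i (X t @^-1` [set j]))).
    by rewrite -(transitionE X_markov)// -EFinM lte_fin mulr_gt0.
  have := sum_seq_le_esum (~` D) (fun i => (mu i)%:E * P i (X t @^-1` [set j]))
    (r := [:: i]) isT.
  by rewrite big_cons big_nil mem_set// adde0.
have : survival t + P_init P D mu (X t @^-1` [set j]) <= 1.
  rewrite -(P_init_setT P mu_distribution).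
  have [m mE] := P_init_measure P mu_distribution; rewrite -mE -measureU//.
  - by apply: le_measure; rewrite ?inE//; apply: measurableU => //; exact: mstay.
  - exact: mstay.
  - apply/seteqP; split=> // w [/= sw Xj]; have := sw t.
    by rewrite add0r t0' lexx Xj => /(_ isT); apply.
apply: lt_le_trans; rewrite lteDl//; exact: survival_fin.
Qed.

Lemma survival_measurable (t : R) : (0 <= t)%R ->
  measurable_fun `[0%R, t] (fun s : R => survival s).
Proof.
move=> t0; have := P_init_stay_measurable X_markov X_qmatrix X_non_explosive
  mu_distribution (@subset_refl _ (~` D)) (@subset_refl _ (~` D)) t0.
apply: eq_measurable_fun => s; rewrite inE/= in_itv/= => /andP[s0 _].
by rewrite -survivalE.
Qed.

Lemma survival_le1 t : (0 <= t)%R -> survival t <= 1.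
Proof.
move=> t0; rewrite -(P_init_setT P mu_distribution).
by apply: P_init_le => //; exact: mstay.
Qed.

Lemma survival_nonincreasing s t : (0 <= s <= t)%R -> survival t <= survival s.
Proof.
move=> /andP[s0 st]; apply: P_init_le; [exact/mstay/(le_trans s0)|exact: mstay|].
by move=> w sw u /andP[u0 us]; apply: sw; rewrite u0 (le_trans us).
Qed.

Lemma lumped_invariant_exponential :
  (forall k t, (0 <= t)%R -> survival_in k t = mubar k * survival t) ->
  (forall t, (0 <= t)%R -> 0 < survival t) ->
  exists2 a : R, (0 < a)%R &
    (forall t, (0 <= t)%R -> survival t = (expR (- a * t))%:E) /\
    lumped_equation Qbar mubar k1 a.
Proof.
move=> inv surv0.
pose Phi (t : R) := \int[lebesgue_measure]_(s in `[0%R, t]) survival s.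
have muE k : mubar k = (fine (mubar k))%:E by rewrite fineK// mubar_fin.
have occE k t : (0 <= t)%R -> occupation t (E k) = mubar k * Phi t.
  move=> t0; rewrite /Phi muE -ge0_integralZl_EFin//.
  - by apply: eq_integral => s; rewrite inE/= in_itv/= => /andP[s0 _]; rewrite inv// muE.
  - exact: survival_measurable.
  - by rewrite fine_ge0// mubar_ge0.
have Phi_ge0 t : 0 <= Phi t by apply: integral_ge0 => s _.
have Phi_fin t : (0 <= t)%R -> Phi t \is a fin_num.
  move=> t0; rewrite ge0_fin_numE//.
  apply: (@le_lt_trans _ _ (\int[lebesgue_measure]_(s in `[0%R, t]) 1)).
    apply: ge0_le_integral => //; first exact: survival_measurable.
    by move=> s; rewrite /= in_itv/= => /andP[s0 _]; exact: survival_le1.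
  by rewrite integral_cst// mul1e /= lebesgue_measure_itv/=; case: ifP; rewrite ltry.
(* Time 1 is an arbitrary positive time. The balances are used there to exclude infinite sums and to
   divide by [r], which is positive. *)
pose r := fine (Phi 1%R).
have rE : Phi 1%R = r%:E by rewrite /r fineK// Phi_fin.
have r0 : (0 < r)%R.
  rewrite -lte_fin -rE; apply: (@lt_le_trans _ _ (survival 1%R)).
    exact: surv0.
  rewrite /Phi -[leLHS]mule1 -[X in _ * X](_ : lebesgue_measure `[0%R, 1%R : R] = _); last first.
    by rewrite lebesgue_measure_itv/= lte_fin ltr01 oppr0 adde0.
  rewrite -(fineK (survival_fin ler01)) -integral_cst//=.
  apply: ge0_le_integral => //.
  - by move=> s _; rewrite lee_fin fine_ge0.
  - exact: survival_measurable.
  - move=> s; rewrite /= in_itv/= => s01; rewrite fineK ?survival_fin//.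
    exact: survival_nonincreasing.
pose beta := \esum_(k in [set k | k != k1]) (mubar k * Qbar k k1).
have sumE l (K : set I) t : (forall k, K k -> k != l) -> (0 <= t)%R ->
    \esum_(k in K) (occupation t (E k) * Qbar k l) =
    (\esum_(k in K) (mubar k * Qbar k l)) * Phi t.
  move=> Kl t0; rewrite -(fineK (Phi_fin t t0)) -esumZr ?fine_ge0//; last first.
    by move=> k Kk; rewrite mule_ge0 ?mubar_ge0 ?qbar_ge0 ?Kl.
  by apply: eq_esum => k _; rewrite occE// fineK ?Phi_fin// muleAC.
have balD t : (0 <= t)%R -> survival t + beta * Phi t = 1.
  move=> t0; rewrite -(mass_balance_D X_markov X_qmatrix q_conservative
    X_non_explosive E_partition E_k1 q_lumpable mu_distribution t0).
  by rewrite sumE.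
have beta0 : 0 <= beta.
  by apply: esum_ge0 => k kk1; rewrite mule_ge0 ?mubar_ge0 ?qbar_ge0.
have sfin := survival_fin ler01.
(* An infinite [beta] multiplied by the positive [Phi 1] could not fit into the balance of total
   mass 1. *)
have [b bE] : exists b : R, beta = b%:E.
  have := balD 1%R ler01; rewrite rE -(fineK sfin); move: beta0.
  case: (beta) => [b _ _|_|//]; first by exists b.
  by rewrite gt0_mulye ?lte_fin.
have b_ge0 : (0 <= b)%R by rewrite -lee_fin -bE.
have survE t : (0 <= t)%R -> survival t = (expR (- b * t))%:E.
  move=> t0; rewrite -[LHS]fineK ?survival_fin//; congr EFin.
  apply: (exp_decay (f := fun t => fine (survival t))) t0 => {}t t0.
    apply: measurable_bounded_integrable => //.
    - by rewrite /= lebesgue_measure_itv/=; case: ifP; rewrite ltry.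
    - apply: (measurableT_comp (f := fine)) => //.
      exact: survival_measurable (ltW t0).
    - exists 1%R; split=> // M M1 s; rewrite /= in_itv/= => /andP[s0 _].
      rewrite ger0_norm ?fine_ge0// (le_trans _ (ltW M1))//.
      by rewrite -lee_fin fineK ?survival_fin ?survival_le1.
  apply: EFin_inj; rewrite EFinD EFinM -bE fineK ?survival_fin// -[RHS](balD t t0).
  congr (_ + _ * _); rewrite /Rintegral -[RHS]fineK ?Phi_fin//; congr (fine _)%:E.
  apply: eq_integral => s; rewrite inE/= in_itv/= => /andP[s0 _].
  by rewrite fineK// survival_fin.
have b0 : (0 < b)%R.
  rewrite lt_neqAle b_ge0 andbT; apply/eqP => b0.
  have [t t0] := survival_lt1; rewrite survE ?ltW//.
  by rewrite -b0 oppr0 mul0r expR0 ltxx.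
exists b => //; split=> // l; have [->|lk1] := eqVneq l k1.
  by rewrite column_k1 -/beta bE mubar_k1 mule0 add0e mule1.
rewrite column_block// mule0 adde0.
have := mass_balance_block X_markov X_qmatrix q_conservative X_non_explosive
  E_partition E_k1 q_lumpable mu_distribution lk1 ler01.
rewrite sumE//; last by move=> k [].
have := balD 1%R ler01.
rewrite inv// occE// rE bE muE -(fineK sfin) -(fineK (qbar_fin l l)).
set p := fine (survival _); set m := fine (mubar l); set c := fine (Qbar l l).
rewrite -!EFinM -EFinD => -[pE].
have gamma0 : 0 <= \esum_(k in [set k | k != k1 /\ k != l]) mubar k * Qbar k l.
  by apply: esum_ge0 => k [_ kl]; rewrite mule_ge0 ?mubar_ge0 ?qbar_ge0.
case: (\esum_(_ in _) _) gamma0 => [g _||//]; last first.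
  by rewrite gt0_mulye ?lte_fin// -EFinN -EFinM -EFinD.
rewrite -!EFinM -!EFinD => -[] H; congr EFin.
(* Substituting [p = 1 - b * r] cancels the initial mass [m] and leaves [r] as a common factor; the
   other factor is the equation of column [l]. *)
have : (r * (g + m * c + b * m) = 0)%R.
  have {}pE : p = (1 - b * r)%R by rewrite -pE addrK.
  rewrite pE in H.
  have -> : (r * (g + m * c + b * m) =
    (m + g * r) - (m * (1 - b * r) + m * r * - c))%R by ring.
  by rewrite H subrr.
by move=> /eqP; rewrite mulf_eq0 gt_eqF//= => /eqP; lra.
Qed.

(** * Truncated block masses as a subsolution *)

Section subsolution.
Context (a : R) (a_gt0 : (0 < a)%R).
Context (mubar_column : forall l, l != k1 ->
  \esum_(k in [set k | k != k1 /\ k != l]) (mubar k * Qbar k l) +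
  mubar l * Qbar l l = (- a)%:E * mubar l).

Local Notation G n := (exhaust (~` D) n).
Local Notation flow := (flow X P mu).
Local Notation block_flow n l s :=
  (\sum_(j <- G n | j \in E l) flow (G n) s j)%R.

(** Only off-diagonal terms are dropped in passing to [K], and they are nonnegative; hence an
    inequality. *)
Lemma mubar_seq_column (K : seq I) l : uniq K -> (forall k, k \in K -> k != k1) ->
  l \in K ->
  (\sum_(k <- K) fine (mubar k) * fine (Qbar k l) <= - a * fine (mubar l))%R.
Proof.
move=> uK Kk1 lK; rewrite (bigD1_seq l)//= -lee_fin EFinD !EFinM.
rewrite !fineK ?mubar_fin// -mubar_column ?Kk1// addeC leeD2r//.
have le := sum_seq_le_esum [set k | k != k1 /\ k != l] (fun k => mubar k * Qbar k l) uK.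
apply: le_trans le; rewrite -sumEFin [leRHS]big_seq_cond [leLHS]big_seq_cond.
rewrite le_eqVlt; apply/orP; left; apply/eqP; apply: eq_big => [k|k _].
  case kK : (k \in K) => //=; apply/idP/idP => [kl|/set_mem[]//].
  by apply/mem_set; split=> //; exact: Kk1.
by rewrite EFinM !fineK ?mubar_fin.
Qed.

(** For each state of [G n], the rates to the states of [E l] inside [G n] fall short of [Qbar] by
    the rate into [E l] outside [G n], whether or not the state lies in [E l]. *)
Lemma block_flow_derivative_le n (K : seq I) (blk : S -> I) l (s : R) :
  uniq K -> (forall j, E (blk j) j) -> (forall j, j \in G n -> blk j \in K) ->
  (\sum_(j <- G n | j \in E l) \sum_(m <- G n) flow (G n) s m * q m j <=
   \sum_(k <- K) block_flow n k s * fine (Qbar k l))%R.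
Proof.
move=> uK blkE blkK; rewrite exchange_big/=.
(* Regrouping by states: [m] is counted once, in the summand of its block [blk m]. *)
have -> : (\sum_(k <- K) block_flow n k s * fine (Qbar k l) =
    \sum_(m <- G n) flow (G n) s m * fine (Qbar (blk m) l))%R.
  under eq_bigr do rewrite mulr_suml big_mkcond.
  rewrite exchange_big/= big_seq [RHS]big_seq; apply: eq_bigr => m mG.
  rewrite -(sum_seq_delta uK (fun k => flow (G n) s m * fine (Qbar k l))%R (blkK m mG)).
  apply: eq_bigr => k _; have [->|kb] := eqVneq k (blk m).
    by rewrite mem_set// mulr1.
  rewrite mulr0 ifF//; apply/negP => /set_mem Ekm.
  by move: kb; rewrite (block_disjoint E_partition Ekm (blkE m)) eqxx.
rewrite big_seq [leRHS]big_seq; apply: ler_sum => m mG.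
rewrite -mulr_sumr ler_wpM2l ?(flow_ge0 X P mu0)//.
have bk1 : blk m != k1.
  apply/eqP => bk1; move: mG; rewrite mem_exhaust => /andP[/set_mem nDm _].
  by apply: nDm; rewrite -E_k1 -bk1.
have uG := exhaust_uniq (~` D) n.
have [bl|bl] := eqVneq (blk m) l.
  have Elm : E l m by rewrite -bl.
  rewrite (sum_rate_diag q_conservative q_off q_diag uG Elm mG) bl.
  rewrite (lumped_qmatrix_diag X_markov X_qmatrix q_conservative E_partition
    q_lumpable _ Elm) -?bl//= gerBl rate_ge0//.
  by case=> _; apply.
have nElm : ~ E l m := block_notin E_partition bl (blkE m).
rewrite (sum_rate_off q_conservative q_off q_diag uG nElm).
rewrite (lumped_qmatrix_off X_markov X_qmatrix q_conservative E_partition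
  q_lumpable bk1 bl (blkE m))/= gerBl rate_ge0//.
by case.
Qed.

Lemma block_flow_le n l (t : R) : l != k1 -> (0 <= t)%R ->
  (block_flow n l t <= fine (mubar l) * expR (- a * t))%R.
Proof.
move=> lk1 t0; have [blk blkE] := choice (block_exists E_partition).
(* The comparison principle needs finitely many unknowns: the blocks met by [G n]. In any other
   block the truncated mass is 0. *)
pose K := undup [seq blk j | j <- G n].
have uK : uniq K by exact: undup_uniq.
have blkK j : j \in G n -> blk j \in K.
  by move=> jG; rewrite mem_undup; exact: map_f.
have Kk1 k : k \in K -> k != k1.
  rewrite mem_undup => /mapP[j jG ->]; apply/eqP => bk1; move: jG.
  rewrite mem_exhaust => /andP[/set_mem nDj _].
  by apply: nDj; rewrite -E_k1 -bk1.
have m0 k : (0 <= fine (mubar k))%R by rewrite fine_ge0// mubar_ge0.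
have [lK|lK] := boolP (l \in K); last first.
  rewrite big_seq_cond big_pred0 ?mulr_ge0 ?expR_ge0// => j.
  apply/negP => /andP[jG /set_mem Elj]; move/negP: lK; apply.
  by rewrite (block_disjoint E_partition Elj (blkE j)); exact: blkK.
pose y l s := (fine (mubar l) * expR (- a * s) - block_flow n l s)%R.
pose dy l s := (fine (mubar l) * (- a * expR (- a * s)) -
  \sum_(j <- G n | j \in E l) \sum_(m <- G n) flow (G n) s m * q m j)%R.
have uG := exhaust_uniq (~` D) n.
have ed (s : R) : is_derive s (1%R : R) (fun s => expR (- a * s))%R
    (- a * expR (- a * s))%R.
  by apply: is_derive_eq; rewrite /GRing.scale/= mulr1 mulrC.
rewrite -subr_ge0 -/(y l t).
apply: (@metzler_ge0 R I K (fun k l => fine (Qbar k l)) y dy) => //.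
- by move=> j k jk; rewrite fine_ge0// qbar_ge0.
- move=> k kK; rewrite /y mulr0 expR0 mulr1 subr_ge0 -lee_fin fineK ?mubar_fin//.
  apply: le_trans (sum_seq_le_esum (E k) (fun i => (mu i)%:E) uG).
  rewrite -sumEFin big_seq_cond [leRHS]big_seq_cond; apply: lee_sum => j /andP[jG _].
  by rewrite (flow0 mu X_markov uG).
- move=> k T _ T0; have [_ fc] := flow_sum_within mu X_markov X_qmatrix (E k) uG T0.
  have ec : {within `[0%R, T], continuous (fun s : R => expR (- a * s))%R}.
    apply: continuous_subspaceT => s.
    by apply/differentiable_continuous/derivable1_diffP; have [] := ed s.
  by move=> s; apply: cvgB; [apply: cvgM; [exact: cvg_cst|exact: ec]|exact: fc].
- move=> k s _ s0; have de := ed s.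
  have df : is_derive s (1%R : R) (fun s : R => block_flow n k s)
      (\sum_(j <- G n | j \in E k) \sum_(m <- G n) flow (G n) s m * q m j)%R.
    rewrite -big_filter; under eq_fun do rewrite -big_filter.
    apply: is_derive_sum_seq => j; rewrite mem_filter => /andP[_ jG].
    exact: (flow_is_derive mu X_markov X_qmatrix uG).
  by apply: is_derive_eq; rewrite /dy /GRing.scale/=; ring.
- move=> k s kK s0; rewrite /y /dy.
  under eq_bigr do rewrite mulrBl mulrAC; rewrite sumrB -mulr_suml.
  rewrite lerD//; last by rewrite lerN2; exact: block_flow_derivative_le.
  rewrite mulrA ler_wpM2r ?expR_ge0// mulrC.
  exact: mubar_seq_column uK Kk1 kK.
Qed.

Lemma survival_in_le l (t : R) : l != k1 -> (0 <= t)%R ->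
  survival_in l t <= mubar l * (expR (- a * t))%:E.
Proof.
move=> lk1 t0.
have c := flow_sum_cvg X_markov X_non_explosive mu_distribution
  (@subset_refl _ (~` D)) (block_subD E_partition E_k1 lk1) t0.
apply: (cvge_to_le c); apply: nearW => n.
by rewrite -[mubar l]fineK ?mubar_fin// -EFinM lee_fin block_flow_le.
Qed.

End subsolution.

Lemma lumped_equation_invariant (a : R) : (0 < a)%R ->
  lumped_equation Qbar mubar k1 a ->
  (forall t, (0 <= t)%R -> survival t = (expR (- a * t))%:E) /\
  (forall k t, (0 <= t)%R -> survival_in k t = mubar k * (expR (- a * t))%:E).
Proof.
move=> a0 eq_a.
have col l : l != k1 ->
    \esum_(k in [set k | k != k1 /\ k != l]) (mubar k * Qbar k l) +
    mubar l * Qbar l l = (- a)%:E * mubar l.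
  by move=> lk1; rewrite -column_block// eq_a (negbTE lk1) mule0 adde0 EFinN.
have colD : \esum_(k in [set k | k != k1]) (mubar k * Qbar k k1) = a%:E.
  by rewrite -column_k1 eq_a mubar_k1 mule0 add0e eqxx mule1.
have le_l l t : l != k1 -> (0 <= t)%R ->
    survival_in l t <= mubar l * (expR (- a * t))%:E.
  by move=> lk1 t0; exact: survival_in_le.
have e0 t : (0 <= expR (- a * t))%R by exact: expR_ge0.
have e1 t : (0 <= t)%R -> (0 <= (1 - expR (- a * t)) / a)%R.
  move=> t0; apply: divr_ge0; last exact: ltW.
  by rewrite subr_ge0 -expR0 ler_expR mulNr oppr_le0 mulr_ge0// ltW.
have sumE t : \esum_(k in [set k | k != k1]) (mubar k * (expR (- a * t))%:E) =
    (expR (- a * t))%:E.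
  by rewrite esumZr ?mubar_sum ?mul1e// => k _; exact: mubar_ge0.
have survE t : (0 <= t)%R -> survival t = (expR (- a * t))%:E.
  move=> t0; apply/eqP; rewrite eq_le; apply/andP; split.
    by rewrite survival_sum// -sumE; apply: le_esum => k /= kk1; exact: le_l.
  (* [(1 - expR (- a * t)) / a] is the integral of [expR (- a * s)] up to [t]. In the loss through
     [D] its denominator cancels against the sum of column [k1], which is [a]. *)
  have occ_le k : k != k1 ->
      occupation t (E k) <= mubar k * ((1 - expR (- a * t)) / a)%:E.
    move=> kk1; rewrite -integral_expR// -[mubar k]fineK ?mubar_fin//.
    have mexp : measurable_fun `[0%R, t] (fun s : R => (expR (- a * s))%:E).
      apply/measurable_EFinP; apply: measurable_funTS.
      by apply: measurableT_comp => //; exact: measurable_funM.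
    rewrite -ge0_integralZl_EFin ?fine_ge0 ?mubar_ge0//.
    apply: ge0_le_integral => //.
    - exact: (P_init_stay_measurable X_markov X_qmatrix X_non_explosive
        mu_distribution (@subset_refl _ (~` D)) (block_subD E_partition E_k1 kk1)).
    - exact: measurable_funeM.
    - move=> s; rewrite /= in_itv/= => /andP[s0 _].
      by rewrite fineK ?mubar_fin//; exact: le_l.
  have := mass_balance_D X_markov X_qmatrix q_conservative
    X_non_explosive E_partition E_k1 q_lumpable mu_distribution t0.
  have : \esum_(k in [set k | k != k1]) (occupation t (E k) * Qbar k k1) <=
      (1 - expR (- a * t))%:E.
    apply: (@le_trans _ _ (\esum_(k in [set k | k != k1])
      (mubar k * Qbar k k1 * ((1 - expR (- a * t)) / a)%:E))).
      apply: le_esum => k /= kk1; rewrite muleAC; apply: lee_wpmul2r.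
        exact: qbar_ge0.
      exact: occ_le.
    rewrite esumZr ?e1//; last first.
      by move=> k /= kk1; rewrite mule_ge0 ?mubar_ge0 ?qbar_ge0.
    by rewrite colD -EFinM mulrCA mulfV ?mulr1// gt_eqF.
  have pos : 0 <= \esum_(k in [set k | k != k1]) (occupation t (E k) * Qbar k k1).
    apply: esum_ge0 => k /= kk1; rewrite mule_ge0 ?qbar_ge0//.
    exact: (occupation_ge0 X P mu_distribution).
  rewrite -(fineK (survival_fin t0)).
  case: (\esum_(_ in _) _) pos => [x _|//|//]; rewrite !lee_fin => xle.
  by rewrite -EFinD => -[] fx; lra.
split=> // k t t0; have [->|kk1] := eqVneq k k1.
  by rewrite survival_in_k1// mubar_k1 mul0e.
(* The block bounds have equal sums, so a strict inequality in one block would be a contradiction;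
   finiteness of the sum over the other blocks keeps the total strict. *)
apply/eqP; rewrite eq_le le_l//= leNgt; apply/negP => lt.
have := survE t t0; rewrite survival_sum// -sumE.
have K1 : [set k | k != k1] `&` [set k] = [set k].
  by apply/seteqP; split=> [j []//|j /= ->].
have mexp0 j : 0 <= mubar j * (expR (- a * t))%:E.
  by rewrite mule_ge0 ?mubar_ge0.
rewrite (esumID [set k] _ (fun j => survival_in j t))//.
rewrite (esumID [set k] _ (fun j => mubar j * _))// K1 !esum_set1//.
have le_rest : \esum_(j in [set k | k != k1] `&` ~` [set k]) survival_in j t <=
    \esum_(j in [set k | k != k1] `&` ~` [set k]) (mubar j * (expR (- a * t))%:E).
  by apply: le_esum => j [/= jk1 _]; exact: le_l.
have rest_fin : \esum_(j in [set k | k != k1] `&` ~` [set k]) survival_in j t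
    \is a fin_num.
  rewrite ge0_fin_numE; last by apply: esum_ge0.
  apply: (@le_lt_trans _ _ (survival t)).
    rewrite survival_sum// [leRHS](esumID [set k])//.
    by apply: leeDr; apply: esum_ge0.
  by rewrite survE// ltry.
move=> E2; have : survival_in k t + \esum_(j in [set k | k != k1] `&` ~` [set k])
    survival_in j t < mubar k * (expR (- a * t))%:E +
    \esum_(j in [set k | k != k1] `&` ~` [set k]) (mubar j * (expR (- a * t))%:E).
  exact: lte_leD.
by rewrite E2 ltxx.
Qed.

End quasi_stationarity.

Theorem theorem7 (R : realType) (d : measure_display)
    (Omega : measurableType d) (S : countType)
    (X : R -> Omega -> S) (P : S -> probability Omega R) (q : S -> S -> R)
    (D : set S) (I : countType) (k1 : I) (E : I -> set S) (mu : S -> R)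
    (X_markov : markov_chain X P)
    (X_irreducible : irreducible_chain X P)
    (X_qmatrix : is_qmatrix X P q)
    (q_conservative : conservative q)
    (X_non_explosive : non_explosive X P)
    (E_partition : partition [set: I] E [set: S])
    (E_two_blocks : exists k : I, k != k1)
    (E_k1 : E k1 = D)
    (q_lumpable : lumpable_off q E k1)
    (mu_distribution : distribution_off D mu) :
  let T := hitting_time X D in
  let Qbar := lumped_qmatrix q E k1 in
  let mubar := block_mass E mu in
  let cond_ii := forall (k : I) (t : R), (0 <= t)%R ->
    (P_cond P D mu (X t @^-1` E k) [set w : Omega | (t%:E < T w)%E])%:E = mubar k in
  let cond_iii := exists2 alpha : R, (0 < alpha)%R &
    lumped_equation Qbar mubar k1 alpha in
  (cond_ii <-> cond_iii) /\
  (cond_ii -> exists alpha : R,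
    [/\ lumped_equation Qbar mubar k1 alpha,
        alpha%:E = ssum [set: I] (fun k => Qbar k k1 * mubar k) &
        exponentially_distributed (P_init P D mu) T alpha]).
Proof.
move=> T Qbar mubar cond_ii cond_iii.
have gtT t : (0 <= t)%R -> [set w | t%:E < T w] = stay X (~` D) t.
  exact: (hitting_time_gt D X_markov).
have condE k t : (0 <= t)%R ->
    P_cond P D mu (X t @^-1` E k) [set w : Omega | t%:E < T w] =
    (fine (P_init P D mu (stay X (~` D) t `&` X t @^-1` E k)) /
     fine (P_init P D mu (stay X (~` D) t)))%R.
  by move=> t0; rewrite /P_cond gtT// setIC.
have exp_of_ii : cond_ii -> exists2 a : R, (0 < a)%R &
    (forall t : R, (0 <= t)%R ->
      P_init P D mu (stay X (~` D) t) = (expR (- a * t))%:E) /\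
    lumped_equation Qbar mubar k1 a.
  move=> ii.
  (* Division by 0 yields 0, so if survival vanished at some time, the conditional probabilities in
     (ii), and with them all of [mubar], would be 0. *)
  have surv_neq0 t : (0 <= t)%R -> fine (P_init P D mu (stay X (~` D) t)) != 0%R.
    move=> t0; apply/eqP => s0.
    have : \esum_(k in [set k | k != k1]) mubar k = 0.
      by apply: esum1 => k _; rewrite -(ii k t t0) condE// s0 invr0 mulr0.
    rewrite (mubar_sum E_partition E_k1 mu_distribution) => /eqP.
    by rewrite onee_eq0.
  apply: (lumped_invariant_exponential X_markov X_irreducible X_qmatrix
    q_conservative X_non_explosive E_partition E_k1 q_lumpable mu_distribution).
    move=> k t t0; rewrite -/mubar -(ii k t t0) condE//.
    rewrite -[X in _ = _ * X]fineK ?survival_fin// -EFinM divfK ?surv_neq0//.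
    by rewrite fineK// survival_in_fin.
  move=> t t0; rewrite lt_neqAle (P_init_ge0 P mu_distribution) andbT eq_sym.
  by apply/eqP => s0; have := surv_neq0 t t0; rewrite s0 eqxx.
split; first split.
- by move=> /exp_of_ii[a a0 [_ eq_a]]; exists a.
- move=> [a a0 eq_a] k t t0; rewrite condE//.
  have [survE inE] := lumped_equation_invariant X_markov X_qmatrix
    q_conservative X_non_explosive E_partition E_k1 q_lumpable mu_distribution
    a0 eq_a.
  rewrite survE// inE//= -/mubar.
  have fin_k := mubar_fin E_partition E_k1 mu_distribution k.
  by rewrite fineM// mulfK ?fineK// gt_eqF// expR_gt0.
- move=> /exp_of_ii[a a0 [survE eq_a]]; exists a; split=> //.
    (* The formula for [alpha] is column [k1] of the lumped equation, where [mubar k1] is 0. *)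
    under eq_fun do rewrite muleC.
    rewrite eq_a /mubar (mubar_k1 E_k1 mu_distribution) mule0 add0e eqxx.
    by rewrite mule1.
  exact: (survival_exponential X_markov mu_distribution).
Qed.
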